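(* Let $W^{(1)},W^{(2)},\ldots$ be an infinite sequence of finite Coxeter groups such that $W^{(n)}$ has rank $n$. Let $X^{(n)}$ be the number of $W^{(n)}$-descents of a uniformly random element of $W^{(n)}$, with variance $s_n^2$. Then $X^{(n)}$ satisfies the CLT if and only if $s_n\to\infty$ as $n\to\infty$.
   Context: For a finite Coxeter group with root system having simple roots $\Delta$ and negative roots $\Phi^-$, the number of descents of $w$ is $\#\{\beta\in\Delta : w(\beta)\in\Phi^-\}$. A sequence of random variables $X^{(n)}$ satisfies the CLT if $(X^{(n)}-\mathbb{E}X^{(n)})/\sqrt{\mathbb{V}X^{(n)}}$ converges in distribution to $N(0,1)$. *)

(* Defs.v *)
From HB Require Import structures.
From mathcomp Require Import all_boot all_order all_algebra.
From mathcomp Require Import all_classical all_reals all_analysis.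
Set Implicit Arguments. Unset Strict Implicit. Unset Printing Implicit Defensive.
Import Order.TTheory GRing.Theory Num.Theory.
Import numFieldNormedType.Exports.
Local Open Scope classical_set_scope.
Local Open Scope ring_scope.

(** A Coxeter matrix of rank n with finite entries (finite Coxeter groups
    have all m_ij finite): m_ii = 1, m_ij = m_ji >= 2 for i <> j. *)
Definition coxeter_matrix (n : nat) (m : 'M[nat]_n) : Prop :=
  (forall i, m i i = 1%N) /\ (forall i j, m i j = m j i) /\
  (forall i j, i != j -> (2 <= m i j)%N).

Section Coxeter.
Variables (R : realType) (n : nat) (m : 'M[nat]_n).

(** Bilinear form of the geometric (Tits) representation on R^n with basis
    the simple roots alpha_i = e_i: B(alpha_i, alpha_j) = - cos (pi / m_ij). *)
Definition coxB (i j : 'I_n) : R := - cos (pi / (m i j)%:R).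

(** Simple reflection s_i : v |-> v - 2 B(alpha_i, v) alpha_i (column vectors). *)
Definition coxrefl (i : 'I_n) : 'M[R]_n :=
  \matrix_(k, j) ((k == j)%:R - 2 * (k == i)%:R * coxB i j).

(** The Coxeter group W (image of the faithful geometric representation):
    all products of simple reflections. *)
Definition coxW : set 'M[R]_n :=
  [set A | exists s : seq 'I_n, A = foldr (@mulmx R n n n) 1%:M (map coxrefl s)].

Definition simple_root (i : 'I_n) : 'cV[R]_n := delta_mx i 0.

Definition roots : set 'cV[R]_n :=
  [set v | exists w i, coxW w /\ v = w *m simple_root i].

Definition neg_roots : set 'cV[R]_n :=
  [set v | roots v /\ forall k, v k 0 <= 0].

Definition ndes (w : 'M[R]_n) : nat :=
  #|[set i : 'I_n | `[< neg_roots (w *m simple_root i) >]]|.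

Definition coxcard : R := (\sum_(w \in coxW) (1 : R))%R.
Definition des_mean : R := (\sum_(w \in coxW) ((ndes w)%:R : R)) / coxcard.
Definition des_var : R :=
  (\sum_(w \in coxW) (((ndes w)%:R : R) - des_mean) ^+ 2) / coxcard.
Definition des_sd : R := Num.sqrt des_var.

Definition des_cdf_std (x : R) : R :=
  (\sum_(w \in coxW)
     (if (((ndes w)%:R : R) - des_mean) / des_sd <= x then 1 else 0 : R)) / coxcard.

End Coxeter.

(** CLT: convergence in distribution of the standardized variables to N(0,1),
    i.e. pointwise convergence of the cdfs to the (continuous) normal cdf. *)
Definition satisfies_CLT (R : realType) (F : nat -> R -> R) : Prop :=
  forall x : R,
    ((fun k => (F k x)%:E) @ \oo --> normal_prob 0 1 `]-oo, x])%E.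

(* Main.v *)
Require Import Defs.
From HB Require Import structures.
From mathcomp Require Import all_boot all_order all_algebra.
From mathcomp Require Import all_classical all_reals all_analysis.
From mathcomp Require Import measurable_realfun ring lra zify.
From mathcomp Require finmap.
Import Order.TTheory GRing.Theory Num.Theory.
Import numFieldNormedType.Exports.
Local Open Scope classical_set_scope.
Local Open Scope ring_scope.
Set Implicit Arguments. Unset Strict Implicit. Unset Printing Implicit Defensive.

(** Let [D_i] be the indicator of a descent at [i] and [Y_i = D_i - 1/2].  By
    the dichotomy of roots, right multiplication by [s_i] flips [D_i], and it
    fixes [D_j] when [s_i] and [s_j] commute.  Hence [Y_i] is uncorrelated with
    every function of the descents at the nodes not adjacent to [i], and
    minimal coset representatives of the dihedral subgroup [<s_i, s_j>] give
    the same for the products [Y_i Y_j]: the Coxeter graph is a dependency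
    graph for the descents.

    Finiteness of the group makes the form positive definite, so every node
    satisfies [sum_(j != i) cos (pi / m_ij) ^ 2 < 1].  Thus a node has at most
    three neighbours, and an edge with [m_ij >= 6] is a whole component.  The
    latter contributes [D_i + D_j - 1], a variable with values in
    [{-1, 0, 1}], to the centred number of descents, and is treated as one
    vertex of the dependency graph.  As [Cov(D_i, D_j) >= 1/(2 m_ij) - 1/4],
    the other nodes contribute to the variance at least a constant times their
    number.  The error in Stein's method is therefore [O(1 / s_n)], and the
    classification of finite Coxeter groups is not needed.

    Conversely, if [s_n] stays bounded along a subsequence, the standardized
    variables are carried by lattices whose step does not tend to [0], and
    their distribution functions cannot converge to a strictly increasing
    function. *)

(** * Lengths and signs of roots *)

Section CoxeterGroup.
Variables (R : realType) (n : nat) (m : 'M[nat]_n).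
Hypothesis Hm : coxeter_matrix m.

Local Notation W := (@coxW R n m).
Local Notation al := (@simple_root R n).
Local Notation s := (@coxrefl R n m).
Local Notation B := (@coxB R n m).

Definition wprod (l : seq 'I_n) : 'M[R]_n :=
  foldr (@mulmx R n n n) 1%:M (map s l).

Definition coxform : 'M[R]_n := \matrix_(i, j) B i j.

Lemma coxB_sym i j : B i j = B j i.
Proof. by rewrite /coxB Hm.2.1. Qed.

Lemma coxB_diag i : B i i = 1.
Proof. by rewrite /coxB Hm.1 divr1 cospi opprK. Qed.

Lemma coxformT : coxform^T = coxform.
Proof. by apply/matrixP => i j; rewrite !mxE coxB_sym. Qed.

Lemma trmx_simple_root_mul i (A : 'M[R]_n) : (al i)^T *m A = row i A.
Proof. by rewrite trmx_delta -rowE. Qed.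

Lemma coxformE i j : (al i)^T *m coxform *m al j = (B i j)%:M.
Proof.
rewrite trmx_simple_root_mul -colE; apply/matrixP => a b.
by rewrite !mxE !ord1 eqxx mulr1n.
Qed.

Lemma coxreflE i : s i = 1%:M - 2 *: (al i *m ((al i)^T *m coxform)).
Proof.
apply/matrixP => a b; rewrite trmx_simple_root_mul !mxE big_ord1 !mxE eqxx andbT.
by rewrite mulrA.
Qed.

Lemma coxrefl_root i j : s i *m al j = al j - (2 * B i j) *: al i.
Proof.
rewrite coxreflE mulmxBl mul1mx -scalemxAl -!mulmxA (mulmxA (al i)^T) coxformE.
by rewrite mul_mx_scalar scalerA.
Qed.

Lemma coxrefl_self i : s i *m al i = - al i.
Proof.
rewrite coxrefl_root coxB_diag mulr1 scaler_nat mulr2n opprD addrA subrr.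
by rewrite sub0r.
Qed.

Lemma mulmx_cols (A A' : 'M[R]_n) : (forall j, A *m al j = A' *m al j) -> A = A'.
Proof.
move=> h; apply/matrixP => a b; have := h b; rewrite -!colE => /matrixP/(_ a 0).
by rewrite !mxE.
Qed.

Lemma coxreflK i : s i *m s i = 1%:M.
Proof.
apply: mulmx_cols => j; rewrite -mulmxA coxrefl_root mulmxBr -scalemxAr.
by rewrite coxrefl_self coxrefl_root mul1mx scalerN opprK subrK.
Qed.

Lemma coxrefl_form i : (s i)^T *m coxform *m s i = coxform.
Proof.
have h : (s i)^T *m coxform = coxform *m s i.
  rewrite coxreflE linearB /= linearZ /= !trmx_mul coxformT trmxK trmx1.
  by rewrite mulmxBl mulmxBr mul1mx mulmx1 -scalemxAl -scalemxAr !mulmxA.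
by rewrite h -mulmxA coxreflK mulmx1.
Qed.

Lemma wprod_cat l1 l2 : wprod (l1 ++ l2) = wprod l1 *m wprod l2.
Proof.
elim: l1 => [|i l IH]; first by rewrite /= /wprod /= mul1mx.
by rewrite /wprod /= in IH *; rewrite IH mulmxA.
Qed.

Lemma wprod1 i : wprod [:: i] = s i.
Proof. by rewrite /wprod /= mulmx1. Qed.

Lemma coxW_wprod l : W (wprod l).
Proof. by exists l. Qed.

Lemma coxW1 : W 1%:M.
Proof. by exists [::]. Qed.

Lemma coxW_refl i : W (s i).
Proof. by exists [:: i]; rewrite /= mulmx1. Qed.

Lemma coxWM u v : W u -> W v -> W (u *m v).
Proof. by move=> [a ->] [b ->]; exists (a ++ b); rewrite -!/(wprod _) wprod_cat. Qed.

Lemma wprod_rev l : wprod l *m wprod (rev l) = 1%:M.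
Proof.
elim: l => [|i l IH]; first by rewrite /wprod /= mulmx1.
rewrite rev_cons -cats1 wprod_cat wprod1 -[in wprod (i :: l)]cat1s wprod_cat wprod1.
by rewrite mulmxA -(mulmxA (s i)) IH mulmx1 coxreflK.
Qed.

Lemma coxW_form u : W u -> u^T *m coxform *m u = coxform.
Proof.
case=> l ->; rewrite -/(wprod l); elim: l => [|i l IH].
  by rewrite /wprod /= trmx1 mul1mx mulmx1.
rewrite -cat1s wprod_cat wprod1 trmx_mul -!mulmxA (mulmxA (s i)^T).
by rewrite (mulmxA (_ *m coxform)) coxrefl_form mulmxA.
Qed.

Lemma coxW_unit u : W u -> u \in unitmx.
Proof.
by case=> l ->; apply: (mulmx1_unit (wprod_rev l)).1.
Qed.

(** A reflection is determined by its root and the form, and [u] preserves the form by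
    [coxW_form]. *)
Lemma conj_refl u i j : W u -> u *m al i = al j -> u *m s i = s j *m u.
Proof.
move=> Wu h; have e : (al j)^T *m coxform *m u = (al i)^T *m coxform.
  by rewrite -h trmx_mul -!mulmxA (mulmxA u^T) coxW_form.
rewrite !coxreflE mulmxBr mulmxBl mulmx1 mul1mx -scalemxAr -scalemxAl.
by rewrite (mulmxA u (al i)) h -(mulmxA (al j)) e.
Qed.

(* The alternating word of length [k] in the letters [i], [j] ending in [j]. *)
Fixpoint altw k (i j : 'I_n) : 'M[R]_n :=
  if k is k'.+1 then altw k' j i *m s j else 1%:M.

Lemma altwSl k i j : altw k.+1 i j = s (if odd k then i else j) *m altw k i j.
Proof.
elim: k i j => [|k IH] i j; first by rewrite /= mul1mx mulmx1.
by rewrite [LHS]/= -/(altw k.+1 j i) IH -mulmxA /=; case: (odd k).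
Qed.

Lemma coxW_altw k i j : W (altw k i j).
Proof.
elim: k i j => [|k IH] i j; first exact: coxW1.
by apply: coxWM (IH _ _) (coxW_refl _).
Qed.

(* The value at [cos (pi / m i j)] of the Chebyshev polynomial [U_(k - 1)]. *)
Definition chebU (i j : 'I_n) (k : nat) : R :=
  sin (k%:R * (pi / (m i j)%:R)) / sin (pi / (m i j)%:R).

Section Dihedral.
Variables i j : 'I_n.
Hypothesis ij : i != j.
Local Notation th := (pi / (m i j)%:R : R).

Lemma angle_itv : 0 < th <= pi / 2.
Proof.
have m2 := Hm.2.2 _ _ ij; have pi0 := @pi_gt0 R.
have mpos : (0 : R) < (m i j)%:R by rewrite ltr0n; lia.
rewrite divr_gt0 //= ler_pM2l // lef_pV2 ?posrE //.
by rewrite (ler_nat _ 2).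
Qed.

Lemma sin_angle_gt0 : 0 < sin th.
Proof.
have /andP[h1 h2] := angle_itv; have pi0 := @pi_gt0 R.
by apply: sin_gt0_pi; rewrite h1 /=; lra.
Qed.

Lemma chebU_ge0 k : (k <= m i j)%N -> 0 <= chebU i j k.
Proof.
move=> km; have m2 := Hm.2.2 _ _ ij; have pi0 := @pi_gt0 R.
have mpos : (0 : R) < (m i j)%:R by rewrite ltr0n; lia.
apply: divr_ge0 (ltW sin_angle_gt0); apply: sin_ge0_pi.
rewrite mulr_ge0 ?ler0n ?divr_ge0 ?ler0n ?(ltW pi0) //=.
by rewrite mulrCA ger_pMr // ler_pdivrMr // mul1r ler_nat.
Qed.

Lemma chebU0 : chebU i j 0 = 0.
Proof. by rewrite /chebU mul0r sin0 mul0r. Qed.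

Lemma chebU1 : chebU i j 1 = 1.
Proof. by rewrite /chebU mul1r divff // gt_eqF // sin_angle_gt0. Qed.

Lemma chebUm : chebU i j (m i j) = 0.
Proof.
have m2 := Hm.2.2 _ _ ij.
have mn0 : (m i j)%:R != 0 :> R by rewrite pnatr_eq0; lia.
by rewrite /chebU mulrCA divff // mulr1 sinpi mul0r.
Qed.

Lemma chebUm1 : chebU i j (m i j).-1 = 1.
Proof.
have m2 := Hm.2.2 _ _ ij.
have mE : (m i j).-1%:R = (m i j)%:R - 1 :> R by rewrite -subn1 natrB //; lia.
have mn0 : (m i j)%:R != 0 :> R by rewrite pnatr_eq0; lia.
rewrite /chebU mE mulrBl mul1r mulrCA divff // mulr1.
rewrite sinB sinpi cospi mul0r sub0r mulN1r opprK divff // gt_eqF //.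
exact: sin_angle_gt0.
Qed.

Lemma chebUSS k :
  chebU i j k.+2 = 2 * cos th * chebU i j k.+1 - chebU i j k.
Proof.
suff e : sin (k.+2%:R * th) = 2 * cos th * sin (k.+1%:R * th) - sin (k%:R * th).
  by rewrite /chebU e mulrBl !mulrA.
have -> : k.+2%:R * th = k.+1%:R * th + th.
  by rewrite -[in LHS]natr1; ring.
have -> : k%:R * th = k.+1%:R * th - th.
  by rewrite -[in RHS]natr1; ring.
rewrite sinD sinB; ring.
Qed.
End Dihedral.

Lemma chebU_sym i j k : chebU i j k = chebU j i k.
Proof. by rewrite /chebU Hm.2.1. Qed.

(** Removing two letters from the right reproduces the recurrence [chebUSS], because [2 * cos th] is
    [- 2 * B i j]. *)
Lemma altw_root k i j : i != j ->
  altw k i j *m al i = chebU i j k.+1 *: al (if odd k then j else i)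
                     + chebU i j k *: al (if odd k then i else j).
Proof.
elim/ltn_ind: k i j => -[|[|k]] IH i j ij.
- by rewrite /= mul1mx chebU0 chebU1 // scale1r scale0r addr0.
- rewrite /= mul1mx coxrefl_root chebUSS // chebU1 // chebU0 scale1r addrC.
  by rewrite subr0 mulr1 [B j i]coxB_sym /coxB mulrN scaleNr opprK.
have ji : j != i by rewrite eq_sym.
rewrite [altw k.+2 i j]/= -/(altw k.+1 j i) -mulmxA coxrefl_root mulmxBr -scalemxAr.
rewrite (IH k.+1) //= -mulmxA coxrefl_self mulmxN IH //.
rewrite [chebU j i _]chebU_sym [chebU j i _]chebU_sym [B j i]coxB_sym /coxB.
rewrite (chebUSS i j k.+1) (chebUSS i j k).
rewrite negbK scalerDr !scalerA.
case: (odd k); rewrite /=; apply/matrixP => a b; rewrite !mxE; ring.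
Qed.

(** By [altw_root] the word with [m i j - 1] letters sends [al i] to a simple root, as [chebU] is
    [1] there and [0] one step later. Then [conj_refl] moves a reflection from its right end to its
    left end. *)
Lemma braid i j : i != j -> altw (m i j) i j = altw (m i j) j i.
Proof.
move=> ij; have m2 := Hm.2.2 _ _ ij.
have mE : m i j = (m i j).-1.+1 by lia.
have h := altw_root (m i j).-1 ij.
rewrite -mE chebUm // chebUm1 // scale0r scale1r add0r in h.
rewrite mE [RHS]/= altwSl; apply/esym/conj_refl; last exact: h.
exact: coxW_altw.
Qed.

(** * Word length and positivity of roots *)

Definition reach k (w : 'M[R]_n) := exists l, size l = k /\ w = wprod l.

Lemma reach_ex w : W w -> exists k, `[< reach k w >].
Proof. by case=> l wl; exists (size l); apply/asboolP; exists l. Qed.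

(** The default [0] is taken only outside [W], by [reach_ex]. *)
Definition len (w : 'M[R]_n) : nat :=
  if pselect (exists k, `[< reach k w >]) is left h then ex_minn h else 0.

Lemma lenP w : W w -> reach (len w) w.
Proof.
move=> /reach_ex h; rewrite /len; case: pselect => // h'.
by case: ex_minnP => k /asboolP.
Qed.

Lemma len_min k w : reach k w -> (len w <= k)%N.
Proof.
move=> h; rewrite /len; case: pselect => [h'|//].
by case: ex_minnP => k' _; apply; apply/asboolP.
Qed.

Lemma reach_catM k k' u v : reach k u -> reach k' v -> reach (k + k')%N (u *m v).
Proof.
by move=> [a [<- ->]] [b [<- ->]]; exists (a ++ b); rewrite size_cat wprod_cat.
Qed.

Lemma reach_refl i : reach 1 (s i).
Proof. by exists [:: i]; rewrite wprod1. Qed.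

Lemma reach_altw k i j : reach k (altw k i j).
Proof.
elim: k i j => [|k IH] i j; first by exists [::].
by rewrite [altw _ _ _]/= -addn1; exact: reach_catM (IH _ _) (reach_refl _).
Qed.

Lemma lenM_altw w k i j : W w -> (len (w *m altw k i j) <= len w + k)%N.
Proof. by move=> Ww; exact: len_min (reach_catM (lenP Ww) (reach_altw _ _ _)). Qed.

Lemma lenMs w i : W w -> (len (w *m s i) <= len w + 1)%N.
Proof. by move=> Ww; exact: len_min (reach_catM (lenP Ww) (reach_refl _)). Qed.

Lemma len_eq0 w : W w -> len w = 0%N -> w = 1%:M.
Proof. by move=> /lenP + l0; rewrite l0 => -[l [/size0nil -> ->]]. Qed.

Lemma mulKs (w : 'M[R]_n) i : w *m s i *m s i = w.
Proof. by rewrite -mulmxA coxreflK mulmx1. Qed.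

Lemma len_descent w : W w -> len w != 0%N -> exists i, (len (w *m s i) < len w)%N.
Proof.
move=> Ww lw; have [l [sl wl]] := lenP Ww.
case/lastP: l sl wl => [sl _|l i]; first by rewrite -sl eqxx in lw.
rewrite size_rcons -cats1 wprod_cat wprod1 => sl wl; exists i.
by rewrite {1}wl mulKs -sl ltnS; apply: len_min; exists l.
Qed.

Definition nonneg (v : 'cV[R]_n) := forall k, 0 <= v k 0.

Lemma nonneg_simple i : nonneg (al i).
Proof. by move=> k; rewrite mxE ler0n. Qed.

Lemma nonnegD u v : nonneg u -> nonneg v -> nonneg (u + v).
Proof. by move=> hu hv k; rewrite mxE addr_ge0. Qed.

Lemma nonnegZ c v : 0 <= c -> nonneg v -> nonneg (c *: v).
Proof. by move=> hc hv k; rewrite mxE mulr_ge0. Qed.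

(* Strip an alternating word in [i], [t] from the right of [w] for as long as
   the length keeps dropping by one at each step; the word has fewer than
   [m i t] letters by the braid relation, so it sends [al i] to a nonnegative
   combination of [al i] and [al t], and induction applies to what remains. *)
Theorem ascent_nonneg w i : W w -> (len w <= len (w *m s i))%N ->
  nonneg (w *m al i).
Proof.
move: {2}(len w) (leqnn (len w)) => N; elim: N w i => [|N IH] w i lN Ww lwi.
  have -> : w = 1%:M by apply: len_eq0 => //; apply/eqP; rewrite -leqn0.
  by rewrite mul1mx; apply: nonneg_simple.
have [lw0|lw0] := eqVneq (len w) 0%N.
  by rewrite (len_eq0 Ww lw0) mul1mx; apply: nonneg_simple.
have [t lt] := len_descent Ww lw0.
have it : i != t by apply: contraTneq lt => <-; rewrite -leqNgt.
pose stripped k v := [/\ W v, w = v *m altw k i t & (len v + k = len w)%N].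
(* With [m i t] letters stripped, the braid relation would give a reduced word for [w] ending in
   [i], so [w *m s i] would be shorter than [w]. *)
have bound k v : stripped k v -> (k < m i t)%N.
  move=> [Wv wE lE]; rewrite ltnNge; apply/negP => mk.
  have m2 := Hm.2.2 _ _ it.
  have [u [Wu uE]] : exists u, reach (k - m i t) u /\ altw k i t = u *m altw (m i t) i t.
    rewrite -(subnK mk); move: (k - m i t)%N => d; rewrite addnK.
    elim: d => [|d [u [ru ed]]]; first by exists 1%:M; split; [exists [::]|rewrite mul1mx].
    rewrite addSn altwSl ed mulmxA; eexists; split; last by [].
    by rewrite -add1n; apply: reach_catM => //; exact: reach_refl.
  rewrite {}uE braid // in wE.
  have mS : m i t = (m i t).-1.+1 by lia.
  have wsE : w *m s i = v *m (u *m altw (m i t).-1 i t).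
    by rewrite wE mS [altw _.+1 _ _]/= !mulmxA mulKs.
  have : (len (w *m s i) <= len v + ((k - m i t) + (m i t).-1))%N.
    rewrite wsE; apply: len_min; apply: reach_catM; first exact: lenP.
    by apply: reach_catM => //; exact: reach_altw.
  lia.
have ex0 : exists k, `[< exists v, stripped k v >].
  exists 1%N; apply/asboolP; exists (w *m s t); split; first exact: coxWM Ww (coxW_refl t).
    by rewrite /= mul1mx mulKs.
  by have := lenMs t (coxWM Ww (coxW_refl t)); rewrite mulKs; lia.
have ub k : `[< exists v, stripped k v >] -> (k <= m i t)%N.
  by move=> /asboolP[v /bound /ltnW].
case: (ex_maxnP ex0 ub) => k /asboolP[v sv] kmax.
have k0 : (0 < k)%N.
  apply: kmax; apply/asboolP; exists (w *m s t); split; first exact: coxWM Ww (coxW_refl t).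
    by rewrite /= mul1mx mulKs.
  by have := lenMs t (coxWM Ww (coxW_refl t)); rewrite mulKs; lia.
have km := bound _ _ sv; case: sv => Wv wE lE.
(* If this next letter shortened [v], it could be stripped too, against the maximality of [k]. *)
have nx : nonneg (v *m al (if odd k then i else t)).
  apply: IH => //; first by lia.
  rewrite leqNgt; apply/negP => lt'.
  suff : (k.+1 <= k)%N by rewrite ltnn.
  apply: kmax; apply/asboolP; exists (v *m s (if odd k then i else t)).
  split; first exact: coxWM Wv (coxW_refl _).
    by rewrite altwSl mulmxA mulKs.
  have := lenMs (if odd k then i else t) (coxWM Wv (coxW_refl (if odd k then i else t))).
  by rewrite mulKs; lia.
(* This is the letter stripped last: if it shortened [v], then [w] would have a word with fewer than
   [len w] letters. *)
have ny : nonneg (v *m al (if odd k then t else i)).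
  apply: IH => //; first by lia.
  case: k k0 wE lE {kmax km nx} => // k _ wE lE.
  have wE' : w = v *m s (if odd k.+1 then t else i) *m altw k i t.
    by rewrite wE altwSl mulmxA /=; case: (odd k).
  have := lenM_altw k i t (coxWM Wv (coxW_refl (if odd k.+1 then t else i))).
  by rewrite -wE'; lia.
rewrite wE -mulmxA altw_root // mulmxDr -!scalemxAr; apply: nonnegD; apply: nonnegZ => //.
  by apply: chebU_ge0.
by apply: chebU_ge0 => //; exact: ltnW.
Qed.
End CoxeterGroup.

(** * Uniform averages over the group *)

Definition avg (R : realType) (T : Type) (s : seq T) (g : T -> R) : R :=
  (\sum_(w <- s) g w) / (size s)%:R.

Section Average.
Variables (R : realType) (T : eqType) (s : seq T).
Implicit Types f g : T -> R.

Lemma eq_avg f g : {in s, f =1 g} -> avg s f = avg s g.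
Proof. by move=> h; congr (_ / _); apply: eq_big_seq => w /h. Qed.

Lemma avgD f g : avg s (fun w => f w + g w) = avg s f + avg s g.
Proof. by rewrite /avg big_split mulrDl. Qed.

Lemma avgZ c f : avg s (fun w => c * f w) = c * avg s f.
Proof. by rewrite /avg -mulr_sumr mulrA. Qed.

Lemma avgN f : avg s (fun w => - f w) = - avg s f.
Proof. by rewrite /avg sumrN mulNr. Qed.

Lemma avgB f g : avg s (fun w => f w - g w) = avg s f - avg s g.
Proof. by rewrite avgD avgN. Qed.

Lemma avg_sum (I : Type) (r : seq I) (P : pred I) (F : I -> T -> R) :
  avg s (fun w => \sum_(i <- r | P i) F i w) = \sum_(i <- r | P i) avg s (F i).
Proof. by rewrite /avg exchange_big mulr_suml. Qed.

Lemma avg_cst (c : R) : (0 < size s)%N -> avg s (fun=> c) = c.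
Proof.
move=> s0; rewrite /avg big_const_seq count_predT iter_addr_0 -[X in X / _]mulr_natr mulfK //.
by rewrite pnatr_eq0 -lt0n.
Qed.

Lemma ler_avg f g : (forall w, w \in s -> f w <= g w) -> avg s f <= avg s g.
Proof.
move=> h; rewrite /avg ler_wpM2r ?invr_ge0 ?ler0n //.
by rewrite big_seq [leRHS]big_seq; exact: ler_sum.
Qed.

Lemma avg_ge0 f : (forall w, w \in s -> 0 <= f w) -> 0 <= avg s f.
Proof.
by move=> h; rewrite mulr_ge0 ?invr_ge0 ?ler0n // big_seq sumr_ge0.
Qed.

Lemma ler_norm_avg f : `|avg s f| <= avg s (fun w => `|f w|).
Proof.
rewrite /avg normrM [`|_^-1|]ger0_norm ?invr_ge0 ?ler0n //.
by rewrite ler_wpM2r ?invr_ge0 ?ler0n // ler_norm_sum.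
Qed.

Lemma avg_exchange (U : Type) (r : seq U) (F : U -> T -> R) :
  avg r (fun u => avg s (F u)) = avg s (fun w => avg r (fun u => F u w)).
Proof. by rewrite /avg -!mulr_suml exchange_big mulrAC. Qed.

Lemma avg_reindex (h : T -> T) f : uniq s -> injective h ->
  {in s, forall w, h w \in s} -> avg s (f \o h) = avg s f.
Proof.
move=> us ih hs; rewrite /avg; congr (_ / _).
rewrite -(big_map h xpredT f); apply: perm_big.
have um : uniq (map h s) by rewrite map_inj_uniq.
apply: uniq_perm => //.
have sub : {subset map h s <= s} by move=> _ /mapP[w ws ->]; exact: hs.
have [|_ eqi] := uniq_min_size um sub; first by rewrite size_map.
exact: eqi.
Qed.
End Average.

(** * Descents and their correlations *)

Section Descents.
Variables (R : realType) (n : nat) (m : 'M[nat]_n).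
Hypothesis Hm : coxeter_matrix m.
Hypothesis Wfin : finite_set (@coxW R n m).

Local Notation W := (@coxW R n m).
Local Notation al := (@simple_root R n).
Local Notation s := (@coxrefl R n m).
Local Notation len := (@len R n m).

Definition des (i : 'I_n) (w : 'M[R]_n) : bool := `[< neg_roots m (w *m al i) >].

Lemma ndesE w : ndes m w = (\sum_(i < n) des i w)%N.
Proof.
rewrite /ndes -sum1_card big_mkcond /=; apply: eq_bigr => i _.
have -> : (i \in [set i | `[< neg_roots m (w *m al i) >]]%classic) = des i w.
  by apply/idP/idP => [/set_mem|h]; [|exact/mem_set].
by case: (des i w).
Qed.

Lemma coxW_root_neq0 w i : W w -> w *m al i != 0.
Proof.
move=> /(coxW_unit Hm) wu; apply/eqP => /(congr1 (mulmx (invmx w))).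
rewrite mulmxA mulVmx // mul1mx mulmx0 => /matrixP/(_ i 0)/eqP.
by rewrite !mxE !eqxx oner_eq0.
Qed.

Lemma nonneg_nonpos (v : 'cV[R]_n) : nonneg v -> nonneg (- v) -> v = 0.
Proof.
move=> h h'; apply/matrixP => a b; rewrite ord1 mxE; apply/eqP.
by rewrite eq_le h -oppr_ge0; have := h' a; rewrite mxE => ->.
Qed.

Lemma desE w i : W w -> des i w <-> nonneg (- (w *m al i)).
Proof.
move=> Ww; split=> [/asboolP[_ h] k|h]; first by rewrite mxE oppr_ge0.
apply/asboolP; split; first by exists w, i.
by move=> k; have := h k; rewrite mxE oppr_ge0.
Qed.

Lemma mulmx_refl_root (w : 'M[R]_n) i : w *m s i *m al i = - (w *m al i).
Proof. by rewrite -mulmxA coxrefl_self // mulmxN. Qed.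

Lemma des_ascent w i : W w -> nonneg (w *m al i) -> ~~ des i w.
Proof.
move=> Ww h; apply/negP => /(desE _ Ww) h'.
by have := coxW_root_neq0 i Ww; rewrite (nonneg_nonpos h h') eqxx.
Qed.

Lemma des_len w i : W w -> (len (w *m s i) <= len w)%N -> des i w.
Proof.
move=> Ww h; apply/desE => //; rewrite -mulmx_refl_root.
apply: (ascent_nonneg Hm) => //; first exact: coxWM Ww (coxW_refl R m i).
by rewrite mulKs.
Qed.

(** [ascent_nonneg] applies to the one of [w] and [w *m s i] that is not longer than the other; the
    two send [al i] to opposite vectors. *)
Lemma des_refl w i : W w -> des i (w *m s i) = ~~ des i w.
Proof.
move=> Ww; have Wws := coxWM Ww (coxW_refl R m i).
have [h|/ltnW h] := leqP (len (w *m s i)) (len w).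
  rewrite (des_len Ww h); apply/negbTE/des_ascent => //.
  by apply: (ascent_nonneg Hm) => //; rewrite mulKs.
rewrite (negbTE (des_ascent Ww (ascent_nonneg Hm Ww h))).
by apply: des_len; rewrite ?mulKs.
Qed.

Lemma coxrefl_comm_root i j : i != j -> m i j = 2%N -> s i *m al j = al j.
Proof.
move=> ij m2; rewrite coxrefl_root // /coxB m2 cos_pihalf oppr0 mulr0 scale0r.
by rewrite subr0.
Qed.

Lemma des_comm w i j : i != j -> m i j = 2%N -> des j (w *m s i) = des j w.
Proof. by move=> ij m2; rewrite /des -mulmxA coxrefl_comm_root. Qed.

Definition coxenum : seq 'M[R]_n := finmap.enum_fset (fset_set W).

Lemma mem_coxenum w : (w \in coxenum) = `[< W w >].
Proof. exact: (in_fset_set Wfin w). Qed.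

Lemma mem_coxenumP w : reflect (W w) (w \in coxenum).
Proof. by rewrite mem_coxenum; exact: asboolP. Qed.

Lemma coxenum_uniq : uniq coxenum. Proof. exact: finmap.fset_uniq. Qed.

Lemma size_coxenum : (0 < size coxenum)%N.
Proof.
have : 1%:M \in coxenum by apply/mem_coxenumP; exact: coxW1.
by case: coxenum.
Qed.

Lemma coxsumE (g : 'M[R]_n -> R) : \sum_(w \in W) g w = \sum_(w <- coxenum) g w.
Proof. by rewrite fsbig_finite. Qed.

Lemma coxavgE (g : 'M[R]_n -> R) :
  (\sum_(w \in W) g w) / coxcard R m = avg coxenum g.
Proof.
rewrite /avg /coxcard !coxsumE; congr (_ / _).
by rewrite big_const_seq count_predT iter_addr_0.
Qed.

Local Notation EW := (@avg R _ coxenum).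

Lemma avg_mulr u (g : 'M[R]_n -> R) : W u -> EW (fun w => g (w *m u)) = EW g.
Proof.
move=> Wu; apply: (@avg_reindex _ _ _ (fun w => w *m u)); first exact: coxenum_uniq.
  move=> x y /(congr1 (mulmx^~ (invmx u))) /=.
  by rewrite -!mulmxA mulmxV ?(coxW_unit Hm) // !mulmx1.
move=> w /mem_coxenumP Ww; apply/mem_coxenumP; exact: coxWM.
Qed.

Definition cdes (i : 'I_n) (w : 'M[R]_n) : R := (des i w)%:R - 2^-1.

Lemma cdes_sqr i w : cdes i w * cdes i w = 4^-1.
Proof. by rewrite /cdes; case: (des i w) => /=; lra. Qed.

Lemma cdes_norm i w : `|cdes i w| = 2^-1.
Proof. by rewrite /cdes; case: (des i w) => /=; [rewrite ger0_norm|rewrite ler0_norm]; lra. Qed.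

Lemma cdes_refl i w : W w -> cdes i (w *m s i) = - cdes i w.
Proof. by move=> Ww; rewrite /cdes des_refl //; case: (des i w) => /=; lra. Qed.

Lemma cdes_comm i j w : i != j -> m i j = 2%N -> cdes j (w *m s i) = cdes j w.
Proof. by move=> ij m2; rewrite /cdes des_comm. Qed.

(** The substitution of [w *m s i] for [w] preserves the average and changes the sign of the
    integrand. *)
Lemma avg_cdes_mul i (F : 'M[R]_n -> R) :
  (forall w, W w -> F (w *m s i) = F w) -> EW (fun w => cdes i w * F w) = 0.
Proof.
move=> h; have := avg_mulr (fun w => cdes i w * F w) (coxW_refl R m i).
rewrite (eq_avg (g := fun w => - (cdes i w * F w))).
  by rewrite avgN; lra.
by move=> w /mem_coxenumP Ww; rewrite /= cdes_refl // h // mulNr.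
Qed.

Lemma avg_cdes i : EW (cdes i) = 0.
Proof.
by rewrite -[RHS](@avg_cdes_mul i (fun=> 1)) //; apply: eq_avg => w _; rewrite mulr1.
Qed.

Lemma avg_des i : EW (fun w => (des i w)%:R) = 2^-1.
Proof.
have := avg_cdes i; rewrite avgB avg_cst ?size_coxenum //.
by move/eqP; rewrite subr_eq0 => /eqP.
Qed.

(** * Dihedral parabolic subgroups *)

Section Parabolic.
Variables i j : 'I_n.
Hypothesis ij : i != j.

Definition par : set 'M[R]_n :=
  [set u | exists l, u = wprod R m l /\ all (mem [:: i; j]) l].

Lemma par_sub : par `<=` W.
Proof. by move=> _ [l [-> _]]; exact: coxW_wprod. Qed.

Lemma par_fin : finite_set par.
Proof. exact: sub_finite_set par_sub Wfin. Qed.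

Lemma par1 : par 1%:M. Proof. by exists [::]. Qed.

Lemma parM u v : par u -> par v -> par (u *m v).
Proof.
move=> [l [-> hl]] [l' [-> hl']]; exists (l ++ l').
by rewrite wprod_cat all_cat hl hl'.
Qed.

Lemma par_refl a : a \in [:: i; j] -> par (s a).
Proof. by move=> h; exists [:: a]; rewrite wprod1 /= h. Qed.

Lemma par_span u a : par u -> a \in [:: i; j] ->
  exists x y, u *m al a = x *: al i + y *: al j.
Proof.
move=> [l [-> hl]] ha; elim: l hl => [_|b l IH /= /andP[hb /IH[x [y e]]]].
  rewrite /wprod /= mul1mx; move: ha; rewrite !inE => /orP[] /eqP ->.
    by exists 1, 0; rewrite scale1r scale0r addr0.
  by exists 0, 1; rewrite scale1r scale0r add0r.
rewrite -cat1s wprod_cat wprod1 -mulmxA e mulmxDr -!scalemxAr !coxrefl_root //.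
move: hb; rewrite !inE => /orP[] /eqP ->.
  exists (x - 2 * coxB R m i i * x - 2 * coxB R m i j * y), y.
  by apply/matrixP => p q; rewrite !mxE; ring.
exists x, (y - 2 * coxB R m j j * y - 2 * coxB R m j i * x).
by apply/matrixP => p q; rewrite !mxE; ring.
Qed.

Lemma nonneg_span x y : nonneg (x *: al i + y *: al j) -> 0 <= x /\ 0 <= y.
Proof.
move=> h; split.
  have := h i; rewrite !mxE !eqxx (negbTE ij) /=.
  by rewrite mulr0 mulr1 addr0.
have := h j; rewrite !mxE !eqxx [j == i]eq_sym (negbTE ij) /=.
by rewrite mulr0 mulr1 add0r.
Qed.

(* The minimal representative [w *m u0] of the coset [w *m par] maps
   [al i] and [al j] to nonnegative vectors, hence preserves the signs of the
   roots in their span. *)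
Lemma par_descents w : W w -> exists2 u0, par u0 &
  forall u a, par u -> a \in [:: i; j] -> des a (w *m u0 *m u) = des a u.
Proof.
move=> Ww.
have ex : exists k, `[< exists2 u, par u & len (w *m u) = k >].
  by exists (len (w *m 1%:M)); apply/asboolP; exists 1%:M => //; exact: par1.
case: (ex_minnP ex) => k /asboolP[u0 pu0 <-] kmin; exists u0 => //.
have Wu0 := coxWM Ww (par_sub pu0).
have pos a : a \in [:: i; j] -> nonneg (w *m u0 *m al a).
  move=> ha; apply: (ascent_nonneg Hm) => //; apply: kmin; apply/asboolP.
  by exists (u0 *m s a); [exact: parM (par_refl ha)|rewrite mulmxA].
have pi := pos i (mem_head _ _).
have pj : nonneg (w *m u0 *m al j) by apply: pos; rewrite !inE eqxx orbT.
move=> u a pu ha; have [x [y e]] := par_span pu ha.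
have Wu := par_sub pu; have Wu' := coxWM Wu0 Wu.
have [hu|hu] := boolP (des a u).
  apply/desE => //; move/desE: hu => /(_ Wu); rewrite -mulmxA e.
  rewrite opprD -!scaleNr => /nonneg_span[x0 y0].
  rewrite -mulmxN opprD -!scaleNr mulmxDr -!scalemxAr.
  by apply: nonnegD; exact: nonnegZ.
apply/negbTE/des_ascent => //; rewrite -mulmxA e.
have : nonneg (u *m al a).
  move: hu; rewrite -(des_refl a Wu) => /desE -/(_ (coxWM Wu (coxW_refl R m a))).
  by rewrite mulmx_refl_root opprK.
rewrite e => /nonneg_span[x0 y0]; rewrite mulmxDr -!scalemxAr.
by apply: nonnegD; exact: nonnegZ.
Qed.

Definition parenum : seq 'M[R]_n := finmap.enum_fset (fset_set par).

Lemma mem_parenumP u : reflect (par u) (u \in parenum).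
Proof.
have -> : (u \in parenum) = `[< par u >] := in_fset_set par_fin u.
exact: asboolP.
Qed.

(** Average first over each coset [w *m par], on which [F] is constant. By [par_descents] the
    descents at [i] and [j] run over those of [par] itself, so the inner average is the same number
    [c] for every coset. *)
Lemma avg_cdes2_mul_neq (F : 'M[R]_n -> R) :
  (forall w, W w -> F (w *m s i) = F w) ->
  (forall w, W w -> F (w *m s j) = F w) ->
  EW (fun w => cdes i w * cdes j w * F w) = EW (fun w => cdes i w * cdes j w) * EW F.
Proof.
pose c := avg parenum (fun u => cdes i u * cdes j u).
have par0 : (0 < size parenum)%N.
  by have /mem_parenumP := par1; case: parenum.
suff main (G : 'M[R]_n -> R) : (forall w, W w -> G (w *m s i) = G w) ->
    (forall w, W w -> G (w *m s j) = G w) ->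
    EW (fun w => cdes i w * cdes j w * G w) = c * EW G.
  (* The case of the constant function [1] identifies [c] with the covariance. *)
  move=> Fi Fj; rewrite main //; congr (_ * _).
  rewrite -[c]mulr1 -(avg_cst (R := R) 1 size_coxenum) -main //.
  by apply: eq_avg => w _; rewrite mulr1.
move=> Gi Gj.
have Gpar w u : W w -> par u -> G (w *m u) = G w.
  move=> + [l [-> hl]]; elim: l w hl => [w _ _|b l IH w /= /andP[hb hl] Ww].
    by rewrite /wprod /= mulmx1.
  rewrite -cat1s wprod_cat wprod1 mulmxA IH //.
    by move: hb; rewrite !inE => /orP[] /eqP ->; [exact: Gi|exact: Gj].
  exact: coxWM Ww (coxW_refl R m b).
transitivity (avg parenum (fun u => EW (fun w => cdes i w * cdes j w * G w))).
  by rewrite avg_cst.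
transitivity (avg parenum (fun u => EW (fun w =>
    cdes i (w *m u) * cdes j (w *m u) * G w))).
  apply: eq_avg => u /mem_parenumP pu.
  rewrite -(avg_mulr _ (par_sub pu)); apply: eq_avg => w /mem_coxenumP Ww.
  by rewrite /= Gpar.
rewrite avg_exchange -avgZ; apply: eq_avg => w /mem_coxenumP Ww.
under [X in avg _ X]eq_fun do rewrite mulrC.
rewrite avgZ mulrC; congr (_ * _).
have [u0 pu0 hu0] := par_descents Ww.
rewrite -(avg_reindex (h := mulmx u0)) ?finmap.fset_uniq //.
- apply: eq_avg => u /mem_parenumP pu; rewrite /= /cdes !mulmxA !hu0 //.
  by rewrite !inE eqxx orbT.
- by rewrite !inE eqxx.
- move=> x y /(congr1 (mulmx (invmx u0))).
  by rewrite !mulmxA mulVmx ?(coxW_unit Hm (par_sub pu0)) // !mul1mx.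
- by move=> u /mem_parenumP pu; apply/mem_parenumP; exact: parM.
Qed.

(** The [2 * m i j] alternating words that exhaust the dihedral subgroup: lengths [0] to [m i j - 1]
    ending in [j], and lengths [1] to [m i j] ending in [i]. *)
Definition altws : seq 'M[R]_n :=
  [seq altw R m k i j | k <- iota 0 (m i j)] ++
  [seq altw R m k j i | k <- iota 1 (m i j)].

Lemma altws_reflr u a : u \in altws -> a \in [:: i; j] -> u *m s a \in altws.
Proof.
have m2 := Hm.2.2 _ _ ij; have ji : j != i by rewrite eq_sym.
have mE : m i j = (m i j).-1.+1 by lia.
have inl k : (k < m i j)%N -> altw R m k i j \in altws.
  by move=> h; rewrite mem_cat (map_f (fun p => altw R m p i j)) // mem_iota.
have inr k : (k < m i j)%N -> altw R m k.+1 j i \in altws.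
  by move=> h; rewrite mem_cat orbC (map_f (fun p => altw R m p j i)) // mem_iota; lia.
have brd : altw R m (m i j) j i = altw R m (m i j) i j by rewrite braid.
rewrite mem_cat => /orP[] /mapP[k + ->]; rewrite mem_iota => /andP[k0 km];
  rewrite !inE => /orP[] /eqP ->.
- by rewrite -/(altw R m k.+1 j i); apply: inr; lia.
- case: k k0 km => [|k] _ km; last first.
    by rewrite /= mulKs //; case: k km => [|k] km; [apply: (inl 0%N)|apply: inr]; lia.
  by rewrite -/(altw R m 1 i j); apply: inl; lia.
- case: k k0 km => // k _ km; rewrite /= mulKs //; apply: inl; lia.
(* At full length the braid relation rewrites the word so that it ends in [j], which the new letter
   cancels. *)
- have [kE|kE] := eqVneq k (m i j).
    rewrite kE brd mE /= mulKs //.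
    case: (m i j).-1 mE => [|p] mE; first by lia.
    by apply: inr; lia.
  rewrite -/(altw R m k.+1 i j); have [kE'|kE'] := eqVneq k.+1 (m i j).
    by rewrite kE' -brd -kE'; apply: inr; lia.
  by apply: inl; lia.
Qed.

Lemma altws_sub u : u \in altws -> W u.
Proof. by rewrite mem_cat => /orP[] /mapP[k _ ->]; exact: coxW_altw. Qed.

Lemma altws1 : 1%:M \in altws.
Proof.
have m2 := Hm.2.2 _ _ ij; rewrite mem_cat; apply/orP; left; apply/mapP.
by exists 0%N => //; rewrite mem_iota; lia.
Qed.

Lemma seq_argmax (T : eqType) (r : seq T) (f : T -> nat) x0 : x0 \in r ->
  exists2 x, x \in r & forall y, y \in r -> (f y <= f x)%N.
Proof.
elim: r x0 => // a r IH x0 _; case: r IH => [_|b r /(_ b (mem_head _ _))[x xr hx]].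
  by exists a; rewrite ?mem_head // => y; rewrite inE => /eqP ->.
have [h|/ltnW h] := leqP (f a) (f x).
  exists x; first by rewrite inE xr orbT.
  by move=> y; rewrite inE => /orP[/eqP ->|/hx].
exists a; first exact: mem_head.
by move=> y; rewrite inE => /orP[/eqP ->|/hx/leq_trans]; last exact.
Qed.

(* Some element of each coset of the dihedral parabolic subgroup, namely a
   longest one, has both descents. *)
Lemma avg_des2 : (2 * (m i j)%:R)^-1 <= EW (fun w => (des i w)%:R * (des j w)%:R).
Proof.
have m2 := Hm.2.2 _ _ ij.
have mpos : (0 : R) < (m i j)%:R by rewrite ltr0n; lia.
set p := EW _.
have : 1 <= (2 * (m i j)%:R) * p; last first.
  by move=> h; rewrite -[leLHS]mulr1 ler_pdivrMl ?mulr_gt0.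
rewrite -[leLHS](avg_cst _ size_coxenum).
(* At least one of the [2 * m i j] translates [w *m u] has both descents, while each translate
   contributes the same average [p]. *)
apply: (@le_trans _ _ (EW (fun w => \sum_(u <- altws)
    (des i (w *m u))%:R * (des j (w *m u))%:R))).
  apply: ler_avg => w /mem_coxenumP Ww.
  have [u ul umax] := seq_argmax (fun u => len (w *m u)) altws1.
  have Wu := coxWM Ww (altws_sub ul).
  rewrite (big_rem u ul) /= !des_len //.
  - by rewrite mulr1 lerDl sumr_ge0 // => v _; rewrite mulr_ge0 ?ler0n.
  - by rewrite -mulmxA; apply: umax; apply: altws_reflr => //; rewrite !inE eqxx orbT.
  - by rewrite -mulmxA; apply: umax; apply: altws_reflr => //; rewrite !inE eqxx.
rewrite avg_sum (eq_big_seq (fun=> p)).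
  rewrite big_const_seq count_predT iter_addr_0 size_cat !size_map !size_iota.
  have -> : p *+ (m i j + m i j) = 2 * (m i j)%:R * p; last exact: lexx.
  by rewrite -[p *+ _]mulr_natr natrD; ring.
by move=> u ul; rewrite (avg_mulr (fun w => (des i w)%:R * (des j w)%:R)) //; exact: altws_sub.
Qed.

Lemma avg_cdes2_ge : (2 * (m i j)%:R)^-1 - 4^-1 <= EW (fun w => cdes i w * cdes j w).
Proof.
rewrite (eq_avg (g := fun w => (des i w)%:R * (des j w)%:R - 2^-1 * (des i w)%:R
   - 2^-1 * (des j w)%:R + 4^-1)).
  rewrite avgD !avgB !avgZ !avg_des avg_cst ?size_coxenum //.
  have := avg_des2; lra.
by move=> w _; rewrite /cdes; case: (des i w); case: (des j w) => /=; lra.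
Qed.
End Parabolic.

Lemma avg_cdes2_mul i j (F : 'M[R]_n -> R) :
  (forall w, W w -> F (w *m s i) = F w) ->
  (forall w, W w -> F (w *m s j) = F w) ->
  EW (fun w => cdes i w * cdes j w * F w) = EW (fun w => cdes i w * cdes j w) * EW F.
Proof.
move=> Fi Fj; have [<-|ij] := eqVneq i j; last exact: avg_cdes2_mul_neq.
have -> : (fun w => cdes i w * cdes i w) = fun=> 4^-1.
  by apply/funext => w; exact: cdes_sqr.
rewrite (avg_cst _ size_coxenum) -avgZ; apply: eq_avg => w _.
by rewrite cdes_sqr.
Qed.

End Descents.

(** * Positivity of the form and the variance *)

Section CosPi.
Variable R : realType.

(** For [c = cos (pi / 3)] the double angle formula reads [2 c^2 - 1 = - c], and [c >= 0] selects
    the root. *)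
Lemma cos_pi3 : cos (pi / 3) = 2^-1 :> R.
Proof.
have pi0 := @pi_gt0 R.
have c0 : 0 <= cos (pi / 3) :> R by apply: cos_ge0_pihalf; apply/andP; split; lra.
have e : cos (pi / 3 + pi / 3) = - cos (pi / 3) :> R.
  by rewrite -[in RHS](cosN (pi / 3)) -cosDpi; congr cos; field.
rewrite cosD -!expr2 sin2cos2 in e.
nra.
Qed.

Lemma sqr_cos_pi4 : cos (pi / 4) ^+ 2 = 2^-1 :> R.
Proof.
have e : cos (pi / 4 + pi / 4) = 0 :> R.
  by rewrite -(cos_pihalf R); congr cos; field.
rewrite cosD -!expr2 sin2cos2 in e; lra.
Qed.

Lemma sqr_cos_pi6 : cos (pi / 6) ^+ 2 = 3 / 4 :> R.
Proof.
have e : cos (pi / 6 + pi / 6) = 2^-1 :> R.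
  by rewrite -cos_pi3; congr cos; field.
rewrite cosD -!expr2 sin2cos2 in e; lra.
Qed.

Lemma le_cos_pi (k l : nat) : (1 < k)%N -> (k <= l)%N ->
  0 <= cos (pi / k%:R : R) <= cos (pi / l%:R : R).
Proof.
move=> k1 kl; have pi0 := @pi_gt0 R.
have kp : (0 : R) < k%:R by rewrite ltr0n; lia.
have lp : (0 : R) < l%:R by rewrite ltr0n; lia.
have h2 : pi / k%:R <= pi / 2 :> R.
  by rewrite ler_pM2l // lef_pV2 ?posrE // (ler_nat _ 2).
have h0 : 0 < pi / l%:R :> R by rewrite divr_gt0.
have hk : 0 < pi / k%:R :> R by rewrite divr_gt0.
have hl : pi / l%:R <= pi / k%:R :> R.
  by rewrite ler_pM2l // lef_pV2 ?posrE // ler_nat.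
apply/andP; split; first by apply: cos_ge0_pihalf; apply/andP; split; lra.
rewrite leNgt ltr_cos; first by rewrite -leNgt.
  by rewrite in_itv /=; apply/andP; split; lra.
by rewrite in_itv /=; apply/andP; split; lra.
Qed.

(* A lower bound for [4 * cos (pi / k) ^+ 2] by an integer. *)
Definition wt (k : nat) : nat :=
  if (k <= 2)%N then 0%N else if (k <= 3)%N then 1%N else if (k <= 5)%N then 2%N else 3%N.

Lemma wt_cos k : (1 < k)%N -> (wt k)%:R <= 4 * cos (pi / k%:R) ^+ 2 :> R.
Proof.
move=> k1; rewrite /wt.
have mono l : (1 < l)%N -> (l <= k)%N ->
    cos (pi / l%:R) ^+ 2 <= cos (pi / k%:R) ^+ 2 :> R.
  by move=> l1 lk; have /andP[a b] := le_cos_pi l1 lk; rewrite ler_pXn2r // nnegrE (le_trans a b).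
case: leqP => [_|k2]; first by rewrite mulr_ge0 ?sqr_ge0.
case: leqP => [_|k3].
  by have := mono 3%N isT k2; rewrite cos_pi3; lra.
case: leqP => [_|k5].
  by have := mono 4%N isT k3; rewrite sqr_cos_pi4; lra.
by have := mono 6%N isT k5; rewrite sqr_cos_pi6; lra.
Qed.

Lemma wt_cos1 k : (1 < k)%N -> (0 < wt k)%N%:R / 2 <= cos (pi / k%:R) :> R.
Proof.
move=> k1; rewrite /wt; case: (leqP k 2) => [_|k2].
  by rewrite mul0r; have /andP[] := le_cos_pi k1 (leqnn k).
have /andP[_] := @le_cos_pi 3 k isT k2; rewrite cos_pi3.
by case: ifP => _; [|case: ifP => _]; rewrite /= mul1r.
Qed.
End CosPi.

(** * Positive definiteness, the shape of the Coxeter graph, and the variance *)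

Section Form.
Variables (R : realType) (n : nat) (m : 'M[nat]_n).
Hypothesis Hm : coxeter_matrix m.
Hypothesis Wfin : finite_set (@coxW R n m).

Local Notation W := (@coxW R n m).
Local Notation al := (@simple_root R n).
Local Notation s := (@coxrefl R n m).
Local Notation B := (@coxB R n m).
Local Notation EW := (@avg R _ (@coxenum R n m)).

Definition dotp (u v : 'cV[R]_n) : R := \sum_k u k 0 * v k 0.

Lemma dotpC u v : dotp u v = dotp v u.
Proof. by apply: eq_bigr => k _; rewrite mulrC. Qed.

Lemma dotp_sumr (I : Type) (r : seq I) u (v : I -> 'cV[R]_n) :
  dotp u (\sum_(i <- r) v i) = \sum_(i <- r) dotp u (v i).
Proof.
rewrite /dotp exchange_big; apply: eq_bigr => k _.
by rewrite summxE mulr_sumr.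
Qed.

Lemma dotpZr u c v : dotp u (c *: v) = c * dotp u v.
Proof. by rewrite /dotp mulr_sumr; apply: eq_bigr => k _; rewrite mxE; ring. Qed.

Lemma dotpDr u v v' : dotp u (v + v') = dotp u v + dotp u v'.
Proof. by rewrite /dotp -big_split; apply: eq_bigr => k _; rewrite mxE mulrDr. Qed.

Lemma dotpNr u v : dotp u (- v) = - dotp u v.
Proof. by rewrite -scaleN1r dotpZr mulN1r. Qed.

Lemma dotpZl u c v : dotp (c *: u) v = c * dotp u v.
Proof. by rewrite dotpC dotpZr dotpC. Qed.

Lemma dotpNl u v : dotp (- u) v = - dotp u v.
Proof. by rewrite dotpC dotpNr dotpC. Qed.

Lemma dotp_suml (I : Type) (r : seq I) (u : I -> 'cV[R]_n) v :
  dotp (\sum_(i <- r) u i) v = \sum_(i <- r) dotp (u i) v.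
Proof. by rewrite dotpC dotp_sumr; apply: eq_bigr => i _; rewrite dotpC. Qed.

Lemma dotpp_ge0 u : 0 <= dotp u u.
Proof. by apply: sumr_ge0 => k _; exact: sqr_ge0. Qed.

Lemma dotpp_gt0 u : u != 0 -> 0 < dotp u u.
Proof.
move=> u0; rewrite lt_neqAle dotpp_ge0 andbT eq_sym.
apply: contra u0; rewrite /dotp psumr_eq0 => [/allP h|k _]; last exact: sqr_ge0.
apply/eqP/matrixP => k l; rewrite ord1 mxE; apply/eqP.
by have := h k (mem_index_enum k); rewrite mulf_eq0 orbb.
Qed.

(* Averaging the standard inner product over [W] gives an invariant one. *)
Definition gram (x y : 'cV[R]_n) : R := EW (fun w => dotp (w *m x) (w *m y)).

(** Invariance under [s i] gives [gram (al i) (al j) = 2 * B i j * gram (al i) (al i) - gram (al i)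
    (al j)]. *)
Lemma gram_root i j : gram (al i) (al j) = B i j * gram (al i) (al i).
Proof.
have := avg_mulr Hm Wfin (fun w => dotp (w *m al i) (w *m al j)) (coxW_refl R m i).
rewrite (eq_avg (g := fun w => 2 * B i j * dotp (w *m al i) (w *m al i)
    - dotp (w *m al i) (w *m al j))).
  by rewrite avgB avgZ /gram; lra.
move=> w _; rewrite -!mulmxA coxrefl_self // coxrefl_root // mulmxN mulmxBr.
by rewrite -scalemxAr dotpNl dotpDr dotpNr dotpZr; ring.
Qed.

Lemma gram_gt0 x : x != 0 -> 0 < gram x x.
Proof.
move=> x0; have s0 := size_coxenum Wfin.
have one : 1%:M \in @coxenum R n m by apply/(mem_coxenumP Wfin); exact: coxW1.
rewrite /gram /avg divr_gt0 ?ltr0n // (big_rem _ one) /= mul1mx.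
rewrite ltr_pwDl ?dotpp_gt0 // sumr_ge0 // => w _; exact: dotpp_ge0.
Qed.

Lemma gramC x y : gram x y = gram y x.
Proof. by apply: eq_avg => w _; rewrite dotpC. Qed.

(** By [gram_root] the positive definite form [gram] differs from [B] only by the squared lengths
    [d i], which agree wherever [B i j] is nonzero. Rescaling each simple root by [Num.sqrt (d i)]
    turns one form into the other. *)
Theorem coxform_pos (x : 'I_n -> R) : (exists i, x i != 0) ->
  0 < \sum_i \sum_j x i * x j * B i j.
Proof.
move=> [i0 xi0]; pose d i := gram (al i) (al i).
have d0 i : 0 < d i.
  apply: gram_gt0; apply/eqP => /matrixP/(_ i 0)/eqP.
  by rewrite !mxE !eqxx oner_eq0.
have dB i j : B i j != 0 -> d i = d j.
  move=> hB; apply: (mulfI hB); rewrite -gram_root gramC gram_root.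
  by rewrite (coxB_sym _ Hm).
have q0 i : 0 < Num.sqrt (d i) by rewrite sqrtr_gt0.
pose y := \sum_i (x i / Num.sqrt (d i)) *: al i.
have yE i : y i 0 = x i / Num.sqrt (d i).
  rewrite summxE (bigD1 i) //= big1 => [|j ji].
    by rewrite !mxE !eqxx mulr1 addr0.
  by rewrite !mxE [i == j]eq_sym (negbTE ji) mulr0.
have yn0 : y != 0.
  apply/eqP => /matrixP/(_ i0 0); rewrite yE mxE => /eqP.
  by rewrite mulf_eq0 (negbTE xi0) invr_eq0 gt_eqF.
suff <- : gram y y = \sum_i \sum_j x i * x j * B i j by exact: gram_gt0.
transitivity (\sum_i \sum_j (x i / Num.sqrt (d i)) * (x j / Num.sqrt (d j)) *
    gram (al i) (al j)).
  rewrite /gram; under [RHS]eq_bigr => i _ do under eq_bigr => j _ do rewrite -avgZ.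
  under [RHS]eq_bigr => i _ do rewrite -avg_sum.
  rewrite -avg_sum; apply: eq_avg => w _.
  rewrite /y mulmx_sumr dotp_suml; apply: eq_bigr => i _.
  rewrite dotp_sumr; apply: eq_bigr => j _.
  by rewrite -!scalemxAr dotpZl dotpZr mulrA.
apply: eq_bigr => i _; apply: eq_bigr => j _; rewrite gram_root -/(d i).
have [->|hB] := eqVneq (B i j) 0; first by rewrite mul0r !mulr0.
rewrite -(dB _ _ hB) -[X in _ * (_ * X)]sqr_sqrtr ?ltW //.
by field; rewrite gt_eqF.
Qed.

Lemma coxB_le0 i j : i != j -> B i j <= 0.
Proof.
move=> ij; have m2 := Hm.2.2 _ _ ij; rewrite oppr_le0.
by have /andP[] := le_cos_pi R m2 (leqnn _).
Qed.

(* Test the form on [al i - sum_(j != i) B i j al j]. *)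
Lemma star_lt1 i : \sum_(j | j != i) B i j ^+ 2 < 1.
Proof.
pose x j := if j == i then 1 else - B i j.
have x0 : exists j, x j != 0 by exists i; rewrite /x eqxx oner_eq0.
have xi : x i = 1 by rewrite /x eqxx.
have xj j : j != i -> x j = - B i j by rewrite /x => /negbTE ->.
have x_ge0 j : 0 <= x j.
  rewrite /x; case: eqVneq => // ji; rewrite oppr_ge0.
  by apply: coxB_le0; rewrite eq_sym.
have := coxform_pos x0; rewrite (bigD1 i) //= (bigD1 i) //= xi (coxB_diag _ Hm).
set S := \sum_(j | j != i) B i j ^+ 2.
have -> : \sum_(j | j != i) 1 * x j * B i j = - S.
  by rewrite -sumrN; apply: eq_bigr => j ji; rewrite xj //; ring.
have : \sum_(j | j != i) \sum_k x j * x k * B j k <= 0; last by lra.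
apply: sumr_le0 => j ji.
(* In row [j] the terms at [i] and at [j] are [- B i j ^+ 2] and [B i j ^+ 2], and cancel; the
   remaining terms are nonpositive. *)
rewrite (bigD1 i) //= (bigD1 j) //= xi (coxB_diag _ Hm) [B j i](coxB_sym _ Hm) xj //.
have : \sum_(k | (k != i) && (k != j)) - B i j * x k * B j k <= 0; last first.
  lra.
apply: sumr_le0 => k /andP[ki kj]; apply: mulr_ge0_le0.
  by rewrite -xj // mulr_ge0.
by apply: coxB_le0; rewrite eq_sym.
Qed.

(** By [wt_cos] and [star_lt1] this sum of integers is strictly below [4]. *)
Lemma star_wt i : (\sum_(j | j != i) wt (m i j) <= 3)%N.
Proof.
rewrite -ltnS -(ltr_nat R) natr_sum.
apply: (@le_lt_trans _ _ (4 * \sum_(j | j != i) B i j ^+ 2)).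
  rewrite mulr_sumr; apply: ler_sum => j ji; rewrite sqrrN; apply: wt_cos.
  by apply: Hm.2.2; rewrite eq_sym.
by have := star_lt1 i; lra.
Qed.

Lemma star_wt2 i j k : j != i -> k != i -> j != k -> (wt (m i j) + wt (m i k) <= 3)%N.
Proof.
move=> ji ki jk; apply: leq_trans (star_wt i).
rewrite (bigD1 j) //= (bigD1 k) /=; last by rewrite ki eq_sym.
by rewrite addnA leq_addr.
Qed.

(* Such a node lies in a dihedral component, by [big_isolated]. *)
Definition big (i : 'I_n) := [exists j, (5 < m i j)%N].

Lemma wt_eq0 i j : i != j -> (wt (m i j) == 0)%N = (m i j == 2)%N.
Proof.
move=> /Hm.2.2 h2; rewrite /wt.
by case: ifP => a; [lia|case: ifP => b; [lia|case: ifP => c; lia]].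
Qed.

Lemma wt_big i j : (5 < m i j)%N -> wt (m i j) = 3%N.
Proof.
move=> h; rewrite /wt; case: ifP => a; first by lia.
by case: ifP => b; [lia|case: ifP => c; lia].
Qed.

Lemma big_neq i j : (5 < m i j)%N -> i != j.
Proof. by apply: contraTneq => <-; rewrite Hm.1. Qed.

(** An edge with [m i j >= 6] has weight [3] and exhausts the bound of [star_wt] at [i]. *)
Lemma big_isolated i j k : (5 < m i j)%N -> k != i -> k != j -> m i k = 2%N.
Proof.
move=> mij ki kj; have ij := big_neq mij.
have ji : j != i by rewrite eq_sym.
have jk : j != k by rewrite eq_sym.
have := star_wt2 ji ki jk; rewrite wt_big // => h.
by apply/eqP; rewrite -wt_eq0 1?eq_sym //; lia.
Qed.

Lemma big_adj i j : big i -> ~~ big j -> i != j -> m i j = 2%N.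
Proof.
move=> /existsP[k mik] nj ij; have [kj|kj] := eqVneq k j.
  by case/negP: nj; apply/existsP; exists i; rewrite Hm.2.1 -kj.
by apply: big_isolated mik _ _; rewrite eq_sym.
Qed.

Definition adj i j := (j != i) && (m i j != 2%N).

Lemma adj_card i : (#|[pred j | adj i j]| <= 3)%N.
Proof.
apply: leq_trans (star_wt i); rewrite -sum1_card big_mkcond [leqRHS]big_mkcond.
apply: leq_sum => j _; rewrite inE /adj; case: eqVneq => //= ji.
have ij : i != j by rewrite eq_sym.
by rewrite -(wt_eq0 ij); case: (wt _).
Qed.

Lemma avg_cdes_comm i j : i != j -> m i j = 2%N ->
  EW (fun w => cdes m i w * cdes m j w) = 0.
Proof.
by move=> ij mij; apply: avg_cdes_mul => // w _; exact: cdes_comm.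
Qed.

(** The coefficients [1 / 15] and [1 / 60] make the bound equal to [1 / (2 m) - 1 / 4], from
    [avg_cdes2_ge], at [m = 3] and [m = 5]; at [m = 4] it is weaker. *)
Lemma cov_bound i j : ~~ big i -> j != i ->
  - (wt (m i j))%:R / 15 - (adj i j)%:R / 60 <= EW (fun w => cdes m i w * cdes m j w).
Proof.
move=> nbi ji; have ij : i != j by rewrite eq_sym.
have m2 := Hm.2.2 _ _ ij.
have m5 : (m i j <= 5)%N.
  by rewrite leqNgt; apply: contra nbi => h; apply/existsP; exists j.
rewrite /adj ji /=; have [mij|mij] := eqVneq (m i j) 2%N.
  by rewrite avg_cdes_comm // mij /wt /= oppr0 !mul0r subrr.
have := avg_cdes2_ge Hm Wfin ij.
have [->|->|->] : [\/ m i j = 3%N, m i j = 4%N | m i j = 5%N].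
  by move: (m i j) m2 m5 mij => [|[|[|[|[|[|]]]]]] //= _ _ _;
    [constructor 1|constructor 2|constructor 3].
all: by rewrite /wt /=; apply: le_trans; lra.
Qed.

(* Summing [cov_bound] with [star_wt] leaves [1 / 20 - deg i / 60] at the node
   [i], that is [1 / 60] plus [(1 - deg i / 2) / 30]; the sum of the latter over
   the nodes is nonnegative, as it bounds the form at the sum of the [al i]. *)
Lemma nonbig_var :
  #|[pred i | ~~ big i]|%:R / 60 <=
  \sum_(i | ~~ big i) \sum_(j | ~~ big j) EW (fun w => cdes m i w * cdes m j w).
Proof.
set S := \sum_(i | _) _.
have deg_le : \sum_(i | ~~ big i) (\sum_(j | j != i) (adj i j)%:R) / 2
    <= #|[pred i | ~~ big i]|%:R :> R.
  have [|] := boolP [exists i, ~~ big i]; last first.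
    rewrite negb_exists => /forallP h; rewrite big1 => [|i bi]; first exact: ler0n.
    by have := h i; rewrite bi.
  move=> /existsP[i0 nb0].
  pose x i : R := (~~ big i)%:R.
  have xex : exists i, x i != 0 by exists i0; rewrite /x nb0 oner_eq0.
  have := coxform_pos xex.
  move=> /ltW h.
  suff : \sum_i \sum_j x i * x j * B i j <=
      \sum_(i | ~~ big i) (1 - (\sum_(j | j != i) (adj i j)%:R) / 2).
    move/(le_trans h); rewrite sumrB subr_ge0 => /le_trans; apply.
    by rewrite (eq_bigl (mem [pred i | ~~ big i])) // sumr_const.
  rewrite (bigID big) /= big1 ?add0r => [|i bi]; last first.
    by rewrite big1 // => j _; rewrite /x bi !mul0r.
  apply: ler_sum => i nbi; rewrite (bigD1 i) //= {1 2}/x nbi mul1r.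
  rewrite (coxB_diag _ Hm) mulr1 lerD2l mulr_suml -sumrN; apply: ler_sum => j ji.
  have ij : i != j by rewrite eq_sym.
  rewrite /x nbi mul1r /adj ji /=; have [bj|nbj] := boolP (big j).
    by rewrite mul0r [m i j]Hm.2.1 big_adj // mul0r oppr0.
  rewrite mul1r lerN2 -wt_eq0 // -lt0n; apply: wt_cos1.
  exact: Hm.2.2.
(* Here [1 / 20] is the variance [1 / 4] of one indicator less [3 / 15]. *)
have row i : ~~ big i ->
    20^-1 - (\sum_(j | j != i) (adj i j)%:R) / 60 <=
    \sum_(j | ~~ big j) EW (fun w => cdes m i w * cdes m j w).
  move=> nbi.
  have -> : \sum_(j | ~~ big j) EW (fun w => cdes m i w * cdes m j w) =
      \sum_j EW (fun w => cdes m i w * cdes m j w).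
    rewrite [RHS](bigID big) /= [X in X + _]big1 ?add0r // => j bj.
    have ij : i != j by apply: contraNneq nbi => ->.
    by apply: avg_cdes_comm => //; rewrite Hm.2.1 big_adj // eq_sym.
  have ii : EW (fun w => cdes m i w * cdes m i w) = 4^-1.
    rewrite -[RHS](avg_cst _ (size_coxenum Wfin)); apply: eq_avg => w _.
    by rewrite cdes_sqr.
  rewrite [leRHS](bigD1 i) //= ii.
  apply: (@le_trans _ _ (4^-1 + \sum_(j | j != i) (- (wt (m i j))%:R / 15 - (adj i j)%:R / 60))).
    have -> : \sum_(j | j != i) (- (wt (m i j))%:R / 15 - (adj i j)%:R / 60) =
        - (\sum_(j | j != i) wt (m i j))%N%:R / 15
        - (\sum_(j | j != i) (adj i j)%:R) / 60 :> R.
      rewrite [LHS]sumrB; congr (_ - _); last by rewrite mulr_suml.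
      by rewrite mulNr natr_sum mulr_suml -sumrN; apply: eq_bigr => j _; rewrite mulNr.
    have : (\sum_(j | j != i) wt (m i j))%N%:R <= 3 :> R by rewrite ler_nat star_wt.
    lra.
  by rewrite lerD2l; apply: ler_sum => j ji; exact: cov_bound.
apply: le_trans (ler_sum _ row); rewrite sumrB -mulr_suml.
rewrite sumr_const -[20^-1 *+ _]mulr_natr.
rewrite -mulr_suml in deg_le.
rewrite -(eq_card (A := [pred i | ~~ big i])) //; lra.
Qed.
End Form.

(** * Stein's method for locally dependent sums *)

Section Stein.
Variables (R : realType) (T : eqType) (s : seq T) (I : finType).
Variables (Y : I -> T -> R) (N : rel I).
Hypothesis s0 : (0 < size s)%N.
Local Notation E := (avg s).

Definition depsum (w : T) : R := \sum_a Y a w.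
Definition outsum (P : pred I) (w : T) : R := \sum_(b | ~~ P b) Y b w.

(** Local dependence enters only as vanishing or factoring correlations with functions of the sum
    outside the neighbourhoods. *)
Hypothesis indep1 : forall a (g : R -> R), E (fun w => Y a w * g (outsum (N a) w)) = 0.
Hypothesis indep2 : forall a b (g : R -> R), N a b ->
  E (fun w => Y a w * Y b w * g (outsum (predU (N a) (N b)) w)) =
  E (fun w => Y a w * Y b w) * E (fun w => g (outsum (predU (N a) (N b)) w)).
Hypothesis Y1 : forall a w, `|Y a w| <= 1.
Hypothesis N4 : forall a, (#|N a| <= 4)%N.

Lemma depsum_split P w : depsum w = outsum P w + \sum_(b | P b) Y b w.
Proof. by rewrite /depsum (bigID P) addrC. Qed.

Lemma norm_sumY (P : pred I) k w : (#|P| <= k)%N -> `|\sum_(b | P b) Y b w| <= k%:R.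
Proof.
move=> Pk; apply: le_trans (ler_norm_sum _ _ _) _.
apply: (@le_trans _ _ (\sum_(b | P b) 1)); first exact: ler_sum.
by rewrite (eq_bigl (mem P)) // sumr_const ler_nat.
Qed.

Lemma var_depsum :
  E (fun w => depsum w ^+ 2) = \sum_a \sum_(b | N a b) E (fun w => Y a w * Y b w).
Proof.
transitivity (E (fun w => \sum_a (Y a w * depsum w))).
  by apply: eq_avg => w _; rewrite -mulr_suml expr2.
rewrite avg_sum; apply: eq_bigr => a _.
rewrite -avg_sum -[RHS]add0r -[X in X + _](indep1 a id) -avgD; apply: eq_avg => w _ /=.
by rewrite (depsum_split (N a)) mulrDr [X in _ + X]mulr_sumr.
Qed.

Variables (f f' : R -> R) (L C sigma : R).
Hypothesis L0 : 0 <= L.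
Hypothesis fL : forall x y, `|f y - f x - f' x * (y - x)| <= L * (y - x) ^+ 2.
Hypothesis f'L : forall x y, `|f' y - f' x| <= L * `|y - x|.
Hypothesis sigma0 : 0 < sigma.
Hypothesis sigmaE : sigma ^+ 2 = E (fun w => depsum w ^+ 2).
(** Absolute moments of neighbouring pairs are controlled by the variance; this reduces the usual
    error of order [sigma ^- 3] times their sum to order [1 / sigma]. *)
Hypothesis C3 :
  \sum_a \sum_(b | N a b) E (fun w => `|Y a w * Y b w|) <= C * sigma ^+ 2.

Let X w := depsum w / sigma.

Let si0 : 0 <= sigma^-1. Proof. by rewrite invr_ge0 ltW. Qed.

(** Expand [f] around [X w] and evaluate at the sum outside [N a], whose image under [f] is
    uncorrelated with [Y a]. In the quadratic remainder one factor [Z] is bounded by [4], the number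
    of neighbours, and the other is kept as a sum over them. *)
Lemma stein_first a :
  `|E (fun w => Y a w * f (X w)) -
    sigma^-1 * \sum_(b | N a b) E (fun w => Y a w * Y b w * f' (X w))|
  <= 4 * L * sigma^-1 ^+ 2 * \sum_(b | N a b) E (fun w => `|Y a w * Y b w|).
Proof.
rewrite -avg_sum -avgZ -[E (fun w => Y a w * f (X w))]subr0.
rewrite -[X in _ - X - _](indep1 a (fun x => f (x / sigma))) -!avgB.
apply: le_trans (ler_norm_avg _ _) _; rewrite -avg_sum -avgZ; apply: ler_avg => w _.
set Z := \sum_(b | N a b) Y b w.
have XE : outsum (N a) w / sigma = X w - Z / sigma.
  by rewrite /X (depsum_split (N a)) mulrDl addrK.
rewrite -mulr_suml -mulr_sumr -/Z XE.
have := fL (X w) (X w - Z / sigma); set r := (r in `|r|) => hr.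
have -> : Y a w * f (X w) - Y a w * f (X w - Z / sigma)
   - sigma^-1 * (Y a w * Z * f' (X w)) = - (Y a w * r) by rewrite /r; ring.
rewrite normrN normrM.
have rE : (X w - Z / sigma - X w) ^+ 2 = sigma^-1 ^+ 2 * `|Z| ^+ 2.
  by rewrite addrAC subrr add0r sqrrN exprMn mulrC real_normK ?num_real.
have Z4 : `|Z| <= 4 := norm_sumY w (N4 a).
have ZY : `|Y a w| * `|Z| <= \sum_(b | N a b) `|Y a w * Y b w|.
  rewrite /Z (le_trans (ler_wpM2l _ (ler_norm_sum _ _ _))) // mulr_sumr.
  by apply: ler_sum => b _; rewrite normrM.
rewrite rE in hr.
apply: (@le_trans _ _ (`|Y a w| * (L * (sigma^-1 ^+ 2 * (4 * `|Z|))))).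
  apply: ler_wpM2l => //; apply: le_trans hr _; apply: ler_wpM2l => //.
  by apply: ler_wpM2l; [exact: sqr_ge0|rewrite expr2 ler_wpM2r].
rewrite [leLHS](_ : _ = 4 * L * sigma^-1 ^+ 2 * (`|Y a w| * `|Z|)); last by ring.
by apply: ler_wpM2l => //; rewrite mulr_ge0 ?mulr_ge0 ?sqr_ge0.
Qed.

(** Dropping the at most [8] terms in the two neighbourhoods changes [f'] by at most [8 * L / sigma]
    and makes it factor out. This replacement is paid for twice, hence [16]. *)
Lemma stein_second a b : N a b ->
  `|E (fun w => Y a w * Y b w * f' (X w)) -
    E (fun w => Y a w * Y b w) * E (fun w => f' (X w))|
  <= 16 * L * sigma^-1 * E (fun w => `|Y a w * Y b w|).
Proof.
move=> Nab; set P := predU (N a) (N b).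
have P8 : (#|P| <= 8)%N.
  apply: (@leq_trans (#|N a| + #|N b|)); last by rewrite (leq_add (N4 a) (N4 b)).
  by rewrite -cardUI leq_addr.
have close w : `|f' (X w) - f' (outsum P w / sigma)| <= 8 * L * sigma^-1.
  apply: le_trans (f'L _ _) _.
  rewrite /X (depsum_split P) mulrDl addrAC subrr add0r normrM.
  rewrite [`|sigma^-1|]gtr0_norm ?invr_gt0 // [8 * L]mulrC -mulrA.
  apply: ler_wpM2l => //; apply: ler_wpM2r; first by rewrite invr_ge0 ltW.
  exact: norm_sumY.
have d1 : `|E (fun w => Y a w * Y b w * (f' (X w) - f' (outsum P w / sigma)))|
   <= 8 * L * sigma^-1 * E (fun w => `|Y a w * Y b w|).
  apply: le_trans (ler_norm_avg _ _) _; rewrite -avgZ; apply: ler_avg => w _.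
  by rewrite normrM mulrC ler_wpM2r.
have d2 : `|E (fun w => f' (outsum P w / sigma) - f' (X w))| <= 8 * L * sigma^-1.
  apply: le_trans (ler_norm_avg _ _) _; rewrite -[leRHS](avg_cst _ s0).
  by apply: ler_avg => w _; rewrite distrC.
rewrite (_ : _ - _ =
   E (fun w => Y a w * Y b w * (f' (X w) - f' (outsum P w / sigma))) +
   E (fun w => Y a w * Y b w) * E (fun w => f' (outsum P w / sigma) - f' (X w))).
  apply: le_trans (ler_normD _ _) _.
  rewrite (_ : 16 * L * sigma^-1 * _ =
     8 * L * sigma^-1 * E (fun w => `|Y a w * Y b w|) +
     E (fun w => `|Y a w * Y b w|) * (8 * L * sigma^-1)); last by ring.
  apply: lerD => //; rewrite normrM; apply: ler_pM => //.
  exact: ler_norm_avg.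
rewrite avgB mulrBr -(indep2 (fun x => f' (x / sigma)) Nab).
under [X in _ = X + _]eq_avg do rewrite mulrBr.
by rewrite avgB -/P; ring.
Qed.

(** The factor [20] is the [4] of [stein_first] plus the [16] of [stein_second]. *)
Theorem stein_bound :
  `|E (fun w => f' (X w)) - E (fun w => X w * f (X w))| <= 20 * L * C / sigma.
Proof.
have sn0 : sigma != 0 by rewrite gt_eqF.
set e := fun a b => E (fun w => `|Y a w * Y b w|).
set c := fun a b => E (fun w => Y a w * Y b w).
set h := fun a b => E (fun w => Y a w * Y b w * f' (X w)).
set m := E (fun w => f' (X w)).
(* As [sigma ^+ 2] is the sum of the covariances of neighbours, [m] is spread over the pairs that
   occur in the expansion. *)
have mE : m = sigma^-1 * \sum_a (sigma^-1 * \sum_(b | N a b) c a b * m).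
  rewrite -mulr_sumr; under eq_bigr do rewrite -mulr_suml.
  by rewrite -mulr_suml -var_depsum -sigmaE expr2; field.
have XfE : E (fun w => X w * f (X w)) = sigma^-1 * \sum_a E (fun w => Y a w * f (X w)).
  rewrite -avg_sum -avgZ; apply: eq_avg => w _.
  by rewrite -mulr_suml -/(depsum w) /X; ring.
rewrite XfE {1}mE -mulrBr normrM gtr0_norm ?invr_gt0 // -sumrB.
rewrite (_ : 20 * L * C / sigma = sigma^-1 * (20 * L * sigma^-1 ^+ 2 * (C * sigma ^+ 2)));
  last by field.
apply: ler_wpM2l; first by rewrite invr_ge0 ltW.
apply: (@le_trans _ _ (20 * L * sigma^-1 ^+ 2 * \sum_a \sum_(b | N a b) e a b)); last first.
  by apply: ler_wpM2l => //; rewrite mulr_ge0 ?mulr_ge0 ?sqr_ge0.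
apply: le_trans (ler_norm_sum _ _ _) _; rewrite mulr_sumr; apply: ler_sum => a _.
rewrite distrC (_ : _ - _ = (E (fun w => Y a w * f (X w)) - sigma^-1 * \sum_(b | N a b) h a b)
   + sigma^-1 * \sum_(b | N a b) (h a b - c a b * m)); last first.
  by rewrite sumrB; ring.
apply: le_trans (ler_normD _ _) _.
rewrite (_ : 20 * _ * _ * _ = 4 * L * sigma^-1 ^+ 2 * (\sum_(b | N a b) e a b) +
   sigma^-1 * \sum_(b | N a b) (16 * L * sigma^-1 * e a b)); last first.
  by rewrite -mulr_sumr; ring.
apply: lerD; first exact: stein_first.
rewrite normrM gtr0_norm ?invr_gt0 //; apply: ler_wpM2l; first by rewrite invr_ge0 ltW.
apply: le_trans (ler_norm_sum _ _ _) _; apply: ler_sum => b Nab.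
exact: stein_second.
Qed.
End Stein.

(** * The dependency graph of the descents *)

Section Units.
Variables (R : realType) (n : nat) (m : 'M[nat]_n).
Hypothesis Hm : coxeter_matrix m.
Hypothesis Wfin : finite_set (@coxW R n m).

Local Notation W := (@coxW R n m).
Local Notation s := (@coxrefl R n m).
Local Notation EW := (@avg R _ (@coxenum R n m)).
Local Notation cd := (@cdes R n m).
Local Notation Big := (big m).
Local Notation isolated := (big_isolated Hm Wfin).

(* The two nodes of a dihedral component with [m >= 6] share a
   representative; every other node represents itself. *)
Definition urep (i : 'I_n) : 'I_n :=
  if [pick j | (5 < m i j)%N] is Some j then (if (j < i)%N then j else i) else i.

Lemma urep_nonbig i : ~~ Big i -> urep i = i.
Proof.
by rewrite /urep => nb; case: pickP => // j h; case/negP: nb; apply/existsP; exists j.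
Qed.

Lemma big_partner i j k : (5 < m i j)%N -> (5 < m i k)%N -> j = k.
Proof.
move=> hj hk; apply/eqP/negPn/negP => jk.
have ki : k != i by rewrite eq_sym; exact: (big_neq Hm hk).
have kj : k != j by rewrite eq_sym.
by rewrite (isolated hj ki kj) in hk.
Qed.

Lemma urep_partner i j : (5 < m i j)%N -> urep i = if (j < i)%N then j else i.
Proof.
move=> h; rewrite /urep; case: pickP => [k hk|/(_ j)]; last by rewrite h.
by rewrite (big_partner h hk).
Qed.

Lemma urep_pair i j : (5 < m i j)%N -> urep i = urep j.
Proof.
move=> h; have h' : (5 < m j i)%N by rewrite Hm.2.1.
have := big_neq Hm h; rewrite (urep_partner h) (urep_partner h').
by case: ltngtP => // /val_inj -> /eqP.
Qed.

Lemma urepP i : urep i = i \/ (5 < m i (urep i))%N.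
Proof.
rewrite /urep; case: pickP => [j hj|_]; last by left.
by case: ifP => _; [right|left].
Qed.

(** Of the two nodes of a large dihedral component the smaller carries both terms, and the larger
    carries the empty sum. *)
Definition udes (a : 'I_n) (w : 'M[R]_n) : R := \sum_(i | urep i == a) cd i w.

Definition uadj : rel 'I_n := fun a b => (a == b) || [&& ~~ Big a, ~~ Big b & adj m a b].

(** An edge joining [i] and [j] either has [m i j >= 6], and then they share a representative, or
    joins two nodes that are not [Big], and then [uadj] records it. *)
Lemma urep_far i j : ~~ uadj (urep i) (urep j) -> i != j /\ m i j = 2%N.
Proof.
rewrite negb_or => /andP[rij nadj].
have ij : i != j by apply: contraNneq rij => ->.
split=> //; apply/eqP/negPn/negP => mij.
have [h|h] := leqP (m i j) 5; last by rewrite (urep_pair h) eqxx in rij.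
have nbi : ~~ Big i.
  apply/negP => bi; have [bj|/(big_adj Hm Wfin bi)/(_ ij)] := boolP (Big j); last first.
    by move/eqP; rewrite (negbTE mij).
  case/existsP: bi => k mik; have [kj|kj] := eqVneq j k.
    by rewrite -kj ltnNge h in mik.
  by case/eqP: mij; apply: (isolated mik) => //; rewrite eq_sym.
have nbj : ~~ Big j.
  apply/negP => bj; case/eqP: mij; rewrite Hm.2.1; apply: (big_adj Hm Wfin) => //.
  by rewrite eq_sym.
move: nadj; rewrite !urep_nonbig // nbi nbj /= /adj mij andbT.
by rewrite eq_sym ij.
Qed.

Lemma udes_nonbig a w : ~~ Big a -> udes a w = cd a w.
Proof.
move=> nb; rewrite /udes (bigD1 a) /=; last by rewrite urep_nonbig.
rewrite big1 ?addr0 // => i /andP[/eqP ia ina].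
have [h|h] := urepP i; first by rewrite -h ia eqxx in ina.
case/negP: nb; apply/existsP; exists i.
by rewrite Hm.2.1 -ia.
Qed.

Lemma udes_norm a w : `|udes a w| <= 1.
Proof.
have [/existsP[j aj]|nb] := boolP (Big a); last first.
  by rewrite udes_nonbig // cdes_norm; lra.
apply: le_trans (ler_norm_sum _ _ _) _.
have ja := big_neq Hm aj.
rewrite (eq_bigr (fun=> 2^-1)) => [|i _]; last by rewrite cdes_norm.
apply: (@le_trans _ _ (\sum_(i in [:: a; j]) 2^-1)).
  rewrite big_mkcond [leRHS]big_mkcond; apply: ler_sum => i _.
  case: eqP => [ia|_]; last by case: ifP => _ //; lra.
  suff -> : i \in [:: a; j] by [].
  have [h|h] := urepP i; first by rewrite -ia h mem_head.
  by rewrite !inE orbC (@big_partner a i j) ?eqxx // Hm.2.1 -ia.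
rewrite -big_uniq /=; last by rewrite inE ja.
by rewrite !big_cons big_nil; lra.
Qed.

Lemma uadj_card a : (#|uadj a| <= 4)%N.
Proof.
apply: (@leq_trans #|predU1 a [pred j | adj m a j]|).
  apply: subset_leq_card; apply/fintype.subsetP => b; rewrite !inE /in_mem /= /uadj eq_sym.
  by case: eqP => //= _ /and3P[].
by rewrite cardU1; apply: leq_add (leq_b1 _) (adj_card Hm Wfin a).
Qed.

Lemma udes_refl i b w : ~~ uadj (urep i) b -> W w -> udes b (w *m s i) = udes b w.
Proof.
move=> nab Ww; apply: eq_bigr => j /eqP jb; rewrite -jb in nab.
by have [ij mij] := urep_far nab; exact: cdes_comm.
Qed.

Lemma outsum_refl (P : pred 'I_n) i w : (forall b, uadj (urep i) b -> P b) -> W w ->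
  outsum udes P (w *m s i) = outsum udes P w.
Proof.
move=> h Ww; apply: eq_bigr => b nb; apply: udes_refl => //.
by apply: contra nb; exact: h.
Qed.

Lemma udes_indep1 a (g : R -> R) : EW (fun w => udes a w * g (outsum udes (uadj a) w)) = 0.
Proof.
rewrite (eq_avg (g := fun w => \sum_(i | urep i == a) cd i w * g (outsum udes (uadj a) w))).
  rewrite avg_sum big1 // => i /eqP ia; apply: avg_cdes_mul => // w Ww.
  by rewrite outsum_refl // ia.
by move=> w _; rewrite mulr_suml.
Qed.

Lemma udes_indep2 a b (g : R -> R) : uadj a b ->
  EW (fun w => udes a w * udes b w * g (outsum udes (predU (uadj a) (uadj b)) w)) =
  EW (fun w => udes a w * udes b w) * EW (fun w => g (outsum udes (predU (uadj a) (uadj b)) w)).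
Proof.
move=> _; set G := fun w => g _.
have YYE (F : 'M[R]_n -> R) : EW (fun w => udes a w * udes b w * F w) =
    \sum_(i | urep i == a) \sum_(j | urep j == b) EW (fun w => cd i w * cd j w * F w).
  under [RHS]eq_bigr do rewrite -avg_sum.
  rewrite -avg_sum; apply: eq_avg => w _; rewrite !mulr_suml.
  by apply: eq_bigr => i _; rewrite mulr_sumr mulr_suml.
have YY1 : EW (fun w => udes a w * udes b w) =
    \sum_(i | urep i == a) \sum_(j | urep j == b) EW (fun w => cd i w * cd j w).
  under [RHS]eq_bigr do rewrite -avg_sum.
  rewrite -avg_sum; apply: eq_avg => w _; rewrite mulr_suml.
  by apply: eq_bigr => i _; rewrite mulr_sumr.
rewrite YYE YY1 mulr_suml; apply: eq_bigr => i /eqP ia.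
rewrite mulr_suml; apply: eq_bigr => j /eqP jb.
apply: avg_cdes2_mul => // w Ww; rewrite /G outsum_refl // => c.
  by rewrite /= ia => ->.
by rewrite /= jb => ->; rewrite orbT.
Qed.

Lemma depsum_udes w : depsum udes w = (ndes m w)%:R - n%:R / 2.
Proof.
rewrite /depsum /udes ndesE natr_sum.
transitivity (\sum_i cd i w); first by rewrite [RHS](partition_big urep xpredT).
rewrite sumrB sumr_const card_ord; congr (_ - _).
by rewrite mulr_natl.
Qed.

(** A [Big] node neighbours only itself, so its products are squares and the absolute values
    disappear. Each other node contributes at most four terms equal to [1 / 4], and [nonbig_var]
    bounds the number of such nodes by [60] times their part of the variance. *)
Lemma udes_abs_cov_le :
  \sum_a \sum_(b | uadj a b) EW (fun w => `|udes a w * udes b w|) <=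
  60 * EW (fun w => depsum udes w ^+ 2).
Proof.
rewrite (var_depsum udes_indep1) (bigID Big) /= [in leRHS](bigID Big) /=.
have nNb a b : Big a -> uadj a b = (b == a).
  by rewrite /uadj => ->; rewrite orbF eq_sym.
have bigE : \sum_(a | Big a) \sum_(b | uadj a b) EW (fun w => `|udes a w * udes b w|) =
            \sum_(a | Big a) \sum_(b | uadj a b) EW (fun w => udes a w * udes b w).
  apply: eq_bigr => a ba; rewrite !(eq_bigl _ _ (fun b => nNb a b ba)) !big_pred1_eq.
  by apply: eq_avg => w _; rewrite ger0_norm // sqr_ge0.
have big0 : 0 <= \sum_(a | Big a) \sum_(b | uadj a b) EW (fun w => udes a w * udes b w).
  apply: sumr_ge0 => a ba; rewrite (eq_bigl _ _ (fun b => nNb a b ba)) big_pred1_eq.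
  by apply: avg_ge0 => w _; exact: sqr_ge0.
have nbE : \sum_(a | ~~ Big a) \sum_(b | uadj a b) EW (fun w => udes a w * udes b w) =
    \sum_(a | ~~ Big a) \sum_(b | ~~ Big b) EW (fun w => cd a w * cd b w).
  apply: eq_bigr => a nba; rewrite big_mkcond [RHS]big_mkcond; apply: eq_bigr => b _.
  have [bb|nbb] := boolP (Big b).
    by rewrite /uadj bb /= andbF orbF; case: eqP => // ab; rewrite ab bb in nba.
  have [_|nab] := boolP (uadj a b).
    by apply: eq_avg => w _; rewrite !udes_nonbig.
  have [] := @urep_far a b; first by rewrite !urep_nonbig.
  by move=> ab mab; rewrite avg_cdes_comm.
have nb_le : \sum_(a | ~~ Big a) \sum_(b | uadj a b) EW (fun w => `|udes a w * udes b w|) <=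
    #|[pred a | ~~ Big a]|%:R.
  rewrite -sumr_const (eq_bigl (mem [pred a | ~~ Big a])) //; apply: ler_sum => a nba.
  apply: (@le_trans _ _ (\sum_(b in uadj a) 4^-1)); last first.
    rewrite sumr_const -[_ *+ _]mulr_natl -ler_pdivlMr // invrK mul1r.
    by rewrite (ler_nat _ _ 4) uadj_card.
  apply: ler_sum => b /orP nab.
  have nbb : ~~ Big b by case: nab => [/eqP <-|/and3P[]].
  rewrite (eq_avg (g := fun=> 4^-1)) ?avg_cst ?size_coxenum // => w _.
  by rewrite !udes_nonbig // normrM !cdes_norm; lra.
rewrite bigE nbE; have := nonbig_var Hm Wfin; lra.
Qed.

Lemma des_meanE : des_mean R m = n%:R / 2.
Proof.
rewrite /des_mean coxavgE // (eq_avg (g := fun w => \sum_i (des m i w)%:R)).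
  rewrite avg_sum; under eq_bigr do rewrite avg_des //.
  by rewrite sumr_const card_ord mulr_natl.
by move=> w _; rewrite ndesE natr_sum.
Qed.

Lemma des_varE : des_var R m = EW (fun w => depsum udes w ^+ 2).
Proof.
rewrite /des_var coxavgE //; apply: eq_avg => w _.
by rewrite depsum_udes des_meanE.
Qed.

Definition sdes (w : 'M[R]_n) : R := ((ndes m w)%:R - des_mean R m) / des_sd R m.

Lemma sdesE w : sdes w = depsum udes w / des_sd R m.
Proof. by rewrite /sdes depsum_udes des_meanE. Qed.

Lemma des_sd_sqr : des_sd R m ^+ 2 = des_var R m.
Proof.
rewrite sqr_sqrtr // des_varE; apply: avg_ge0 => w _; exact: sqr_ge0.
Qed.

Lemma avg_sdes_sqr : 0 < des_sd R m -> EW (fun w => sdes w ^+ 2) = 1.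
Proof.
move=> sd0; have sdn : des_sd R m != 0 by rewrite gt_eqF.
rewrite (eq_avg (g := fun w => (des_sd R m) ^- 2 * depsum udes w ^+ 2)).
  by rewrite avgZ -des_varE -des_sd_sqr mulVf // expf_neq0.
by move=> w _; rewrite sdesE exprMn exprVn mulrC.
Qed.

(** The constant is [20 * 60], from [stein_bound] and [udes_abs_cov_le]. *)
Theorem sdes_stein (f f' : R -> R) (L : R) : 0 < des_sd R m -> 0 <= L ->
  (forall x y, `|f y - f x - f' x * (y - x)| <= L * (y - x) ^+ 2) ->
  (forall x y, `|f' y - f' x| <= L * `|y - x|) ->
  `|EW (fun w => f' (sdes w)) - EW (fun w => sdes w * f (sdes w))|
    <= 1200 * L / des_sd R m.
Proof.
move=> sd0 L0 fL f'L.
have sE : des_sd R m ^+ 2 = EW (fun w => depsum udes w ^+ 2).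
  by rewrite des_sd_sqr des_varE.
have C3 := udes_abs_cov_le; rewrite -sE in C3.
have := stein_bound (size_coxenum Wfin) udes_indep1 udes_indep2 udes_norm uadj_card L0 fL f'L
  sd0 sE C3.
rewrite (_ : 20 * L * 60 = 1200 * L); last by ring.
have -> : EW (fun w => f' (sdes w)) = EW (fun w => f' (depsum udes w / des_sd R m)).
  by apply: eq_avg => w _; rewrite sdesE.
have -> // : EW (fun w => sdes w * f (sdes w)) =
    EW (fun w => depsum udes w / des_sd R m * f (depsum udes w / des_sd R m)).
by apply: eq_avg => w _; rewrite !sdesE.
Qed.
End Units.

(** * Solutions of the Stein equation *)

Section Normal.
Variable R : realType.
Local Notation mu := (@lebesgue_measure R).
Implicit Types (q f g d : R -> R) (x y a b K : R).

Definition lip K q := forall x y, `|q y - q x| <= K * `|y - x|.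

Lemma lip_continuous K q : lip K q -> continuous q.
Proof.
move=> h x; apply/cvgrPdist_le => e e0.
have K1 : 0 < `|K| + 1 by rewrite ltr_wpDl.
near=> y; rewrite distrC; apply: le_trans (h _ _) _.
apply: (@le_trans _ _ ((`|K| + 1) * `|y - x|)).
  by rewrite ler_wpM2r // (le_trans (ler_norm K)) // lerDl.
rewrite -ler_pdivlMl // mulrC distrC; near: y; apply: cvgr_dist_le => //.
by rewrite divr_gt0.
Unshelve. all: by end_near. Qed.

Lemma is_derive_continuous g d : (forall x, is_derive x 1 g (d x)) -> continuous g.
Proof.
move=> h x; apply: differentiable_continuous; apply/derivable1_diffP.
by have [] := h x.
Qed.

Lemma mvt_ex g d x y : (forall x, is_derive x 1 g (d x)) ->
  exists2 c, `|c - x| <= `|y - x| & g y - g x = d c * (y - x).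
Proof.
move=> h; have cg := is_derive_continuous h.
have [xy|yx|->] := ltgtP x y.
- have [|c cI e] := MVT xy (fun z _ => h z); first exact: continuous_subspaceT.
  exists c => //; move: cI; rewrite in_itv /= => /andP[c1 c2].
  by rewrite !ger0_norm; lra.
- have [|c cI e] := MVT yx (fun z _ => h z); first exact: continuous_subspaceT.
  exists c; first by move: cI; rewrite in_itv /= => /andP[c1 c2]; rewrite !ler0_norm; lra.
  by rewrite -opprB e -mulrN opprB.
- by exists y => //; rewrite !subrr mulr0.
Qed.

Lemma mvt_lip g d K : (forall x, is_derive x 1 g (d x)) ->
  (forall x, `|d x| <= K) -> lip K g.
Proof.
by move=> h dK x y; have [c _ ->] := mvt_ex x y h; rewrite normrM ler_wpM2r.
Qed.

Lemma compact_supp_bound d a b : a <= b -> continuous d ->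
  (forall x, x <= a -> d x = 0) -> (forall x, b <= x -> d x = 0) ->
  exists2 K, 0 <= K & forall x, `|d x| <= K.
Proof.
move=> ab cd da db.
have [|c _ hc] := @EVT_max _ (fun x => `|d x|) a b ab.
  by apply: continuous_subspaceT => x; apply: cvg_norm; exact: cd.
exists `|d c| => // x; have [xa|ax] := leP x a; first by rewrite da // normr0.
have [bx|xb] := leP b x; first by rewrite db // normr0.
by apply: hc; rewrite in_itv /= !ltW.
Qed.

Definition phi : R -> R := normal_pdf 0 1.
Definition peak : R := normal_peak 1.

Lemma peak_gt0 : 0 < peak. Proof. exact: normal_peak_gt0 (oner_neq0 R). Qed.

Lemma phiE x : phi x = peak * expR (- x ^+ 2 / 2).
Proof.
by rewrite /phi normal_pdfE ?oner_neq0 // /normal_fun subr0 expr1n.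
Qed.

Lemma phi_gt0 x : 0 < phi x.
Proof. by rewrite phiE mulr_gt0 ?peak_gt0 ?expR_gt0. Qed.

Lemma phi_le x : phi x <= peak.
Proof. exact: normal_pdf_ub (oner_neq0 R). Qed.

Lemma phi_continuous : continuous phi.
Proof. exact: continuous_normal_pdf (oner_neq0 R). Qed.

Lemma phi_integrable : mu.-integrable setT (EFin \o phi).
Proof. exact: integrable_normal_pdf. Qed.

(** The reciprocal of [phi], and the integrating factor of the Stein equation
    [f' x - x * f x = q x]. *)
Definition invphi x : R := peak^-1 * expR (x ^+ 2 / 2).

Lemma phi_inv x : phi x * invphi x = 1.
Proof.
rewrite phiE /invphi mulrACA divff ?gt_eqF ?peak_gt0 // -expRD mulNr addNr expR0.
by rewrite mulr1.
Qed.

Lemma is_derive_invphi x : is_derive x 1 invphi (x * invphi x).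
Proof.
have hsq : is_derive x 1 (fun y : R => y ^+ 2 / 2) x.
  rewrite (_ : (fun y => _) = 2^-1 \*: (@id R * @id R)); last first.
    by apply/funext => y; rewrite !fctE /GRing.scale /= expr2 mulrC.
  by apply: is_derive_eq; rewrite /GRing.scale /=; field.
have h : is_derive x 1 invphi _ :=
  is_deriveZ peak^-1 (is_derive1_comp (is_derive_expR _) hsq).
by apply: (is_derive_eq h); rewrite /invphi /GRing.scale /=; ring.
Qed.

Lemma phi_mul_integrable q K : continuous q -> (forall x, `|q x| <= K) ->
  mu.-integrable setT (EFin \o (fun x => q x * phi x)).
Proof.
move=> cq qK.
apply: (@le_integrable _ _ _ mu setT measurableT _ (EFin \o (fun x => K * phi x))) => //.
- apply/measurable_EFinP; apply: measurable_funM; apply: continuous_measurable_fun => //.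
  exact: phi_continuous.
- move=> x _; rewrite /= lee_fin !normrM ler_wpM2r //.
  by apply: le_trans (qK x) (ler_norm _).
- exact: (integrableZl measurableT K phi_integrable).
Qed.

Definition gint q : R := \int[mu]_x (q x * phi x).

(* [f] is compactly supported because [q] has zero Gaussian integral, so all
   the derivatives below are automatically bounded. *)
Theorem stein_solution q K a b : 0 <= K -> lip K q -> a <= b ->
  (forall x, x <= a -> q x = 0) -> (forall x, b <= x -> q x = 0) -> gint q = 0 ->
  exists f f' L, [/\ 0 <= L,
    (forall x y, `|f y - f x - f' x * (y - x)| <= L * (y - x) ^+ 2),
    (forall x y, `|f' y - f' x| <= L * `|y - x|) &
    forall x, f' x - x * f x = q x].
Proof.
move=> K0 qL ab qa qb q0.
have cq := lip_continuous qL.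
have [M M0 qM] := compact_supp_bound ab cq qa qb.
have iq := phi_mul_integrable cq qM.
pose F x := \int[mu]_(t in `]-oo, x]) (q t * phi t).
have dF x : is_derive x 1 F (q x * phi x).
  have [] := @continuous_FTC1 R (fun t => q t * phi t) -oo%O x (x + 1).
  - by rewrite ltrDl.
  - exact: integrableS iq.
  - by rewrite ltNyr.
  - by apply: cvgM; [exact: cq|exact: phi_continuous].
  by move=> dx dE; exact: (DeriveDef dx (etrans (esym (derive1E _ _)) dE)).
have Fa x : x <= a -> F x = 0.
  move=> xa; rewrite /F (eq_Rintegral mu (g := fun=> 0)) ?Rintegral_cst ?mul0r //.
  move=> t; rewrite inE /= in_itv /= => tx.
  by rewrite qa ?mul0r // (le_trans tx).
(* Beyond [b] the primitive has already reached the full integral [gint q], which is [0]. *)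
have Fb x : b <= x -> F x = 0.
  move=> bx; rewrite -q0 /gint /F Rintegral_mkcond; apply: eq_Rintegral => t _.
  rewrite patchE; case: ifPn => //; rewrite notin_setE /= in_itv /= => /negP.
  by rewrite -ltNge => /ltW xt; rewrite qb ?mul0r // (le_trans bx).
pose f x := F x * invphi x.
have df x : is_derive x 1 f (q x + x * f x).
  have h : is_derive x 1 f _ := is_deriveM (dF x) (is_derive_invphi x).
  apply: (is_derive_eq h); rewrite /GRing.scale /f /=; have e := phi_inv x.
  transitivity (q x * (phi x * invphi x) + x * (F x * invphi x)); first by ring.
  by rewrite e mulr1.
have cf := is_derive_continuous df.
(* Since [f' = q + g], a bound on the derivative [d] of [g] makes [f'] Lipschitz; [d] is continuous
   with compact support. *)
pose g x := x * f x.
pose d x := f x + x * (q x + x * f x).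
have dg x : is_derive x 1 g (d x).
  have h : is_derive x 1 g _ := is_deriveM (is_derive_id x 1) (df x).
  by apply: (is_derive_eq h); rewrite /GRing.scale /= /d; ring.
have cd : continuous d.
  move=> x; apply: cvgD; first exact: cf.
  apply: cvgM; first exact: cvg_id.
  by apply: cvgD; [exact: cq|apply: cvgM; [exact: cvg_id|exact: cf]].
have fa x : x <= a -> f x = 0 by move=> xa; rewrite /f Fa ?mul0r.
have fb x : b <= x -> f x = 0 by move=> bx; rewrite /f Fb ?mul0r.
have [N N0 dN] : exists2 N, 0 <= N & forall x, `|d x| <= N.
  apply: (compact_supp_bound ab cd) => x h.
    by rewrite /d fa // qa // mulr0 addr0 mulr0 addr0.
  by rewrite /d fb // qb // mulr0 addr0 mulr0 addr0.
have gN := mvt_lip dg dN.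
have f'L : lip (K + N) (fun x => q x + x * f x).
  move=> x y; rewrite opprD addrACA (le_trans (ler_normD _ _)) // mulrDl.
  by apply: lerD; [exact: qL|exact: gN].
exists f, (fun x => q x + x * f x), (K + N); split => //.
- exact: addr_ge0.
- move=> x y; have [c cx ->] := mvt_ex x y df.
  rewrite -mulrBl normrM -real_normK ?num_real // expr2 [leRHS]mulrA ler_wpM2r //.
  by apply: le_trans (f'L _ _) _; rewrite ler_wpM2l // addr_ge0.
- by move=> x; rewrite addrK.
Qed.
End Normal.

(** * Convergence to the normal distribution *)

Section Limit.
Variable R : realType.
Local Notation mu := (@lebesgue_measure R).
Local Notation phi := (@phi R).
Local Notation peak := (@peak R).
Implicit Types (q f g : R -> R) (x y a b d K : R).

Definition Phi x : R := \int[mu]_(t in `]-oo, x]) phi t.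

Lemma PhiE x : normal_prob 0 1 `]-oo, x] = (Phi x)%:E.
Proof.
rewrite /Phi /Rintegral fineK //; apply: integrable_fin_num => //.
exact: integrableS (@phi_integrable R).
Qed.

Lemma is_derive_Phi x : is_derive x 1 Phi (phi x).
Proof.
have [] := @continuous_FTC1 R phi -oo%O x (x + 1).
- by rewrite ltrDl.
- exact: integrableS (@phi_integrable R).
- by rewrite ltNyr.
- exact: phi_continuous.
by move=> dx dE; exact: (DeriveDef dx (etrans (esym (derive1E _ _)) dE)).
Qed.

Lemma Phi_lt x y : x < y -> Phi x < Phi y.
Proof.
move=> xy; rewrite -subr_gt0; have [c _ ->] := mvt_ex x y is_derive_Phi.
by rewrite mulr_gt0 ?phi_gt0 ?subr_gt0.
Qed.

Lemma Phi_le x y : x <= y -> Phi x <= Phi y.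
Proof. by rewrite le_eqVlt => /predU1P[->//|/Phi_lt/ltW]. Qed.

Lemma Phi_lip x y : x <= y -> Phi y - Phi x <= peak * (y - x).
Proof.
move=> xy; have [c _ ->] := mvt_ex x y is_derive_Phi.
by rewrite ler_wpM2r ?subr_ge0 ?phi_le.
Qed.

Lemma Phi_ge0 x : 0 <= Phi x.
Proof. by apply: Rintegral_ge0 => t _; exact/ltW/phi_gt0. Qed.

Lemma Phi_le1 x : Phi x <= 1.
Proof.
have : (normal_prob 0 1 (`]-oo, x]%classic : set R) <= 1)%E.
  exact: (@probability_le1 _ _ _ (normal_prob 0 1)).
by rewrite PhiE lee_fin.
Qed.

Lemma PhiB x y : x <= y -> normal_prob 0 1 `]x, y] = (Phi y - Phi x)%:E.
Proof.
move=> xy.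
have U : `]-oo, y]%classic = `]-oo, x]%classic `|` `]x, y]%classic :> set R.
  by rewrite -itv_bndbnd_setU // ?bnd_simp.
have : normal_prob 0 1 (`]-oo, x]%classic `|` `]x, y]%classic : set R) =
    (normal_prob 0 1 `]-oo, x] + normal_prob 0 1 `]x, y])%E.
  apply: (@measureU _ _ _ (normal_prob 0 1)) => //.
  apply/seteqP; split=> // z []; rewrite /= !in_itv /= => zx /andP[xz _].
  by rewrite leNgt xz in zx.
rewrite -U !PhiE EFinB => ->.
by rewrite addeAC subee // add0e.
Qed.

(** The intervals [F n] exhaust the line, so their normal probabilities tend to [1]; monotonicity of
    [Phi] does the rest. *)
Lemma Phi_tails (e : R) : 0 < e ->
  exists K0, forall K, K0 <= K -> Phi (- K) <= e /\ 1 - e <= Phi K.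
Proof.
move=> e0; pose F (n : nat) := `](- n%:R), (n%:R : R)]%classic.
have h : normal_prob 0 1 \o F @ \oo --> normal_prob 0 1 (\bigcup_n F n).
  apply: nondecreasing_cvg_mu; first by move=> n; exact: measurable_itv.
    by apply: bigcup_measurable => n _; exact: measurable_itv.
  move=> n k nk; apply/subsetPset => z; rewrite /F /= !in_itv /= => /andP[a b].
  have : n%:R <= k%:R :> R by rewrite ler_nat.
  by move=> c; apply/andP; split; lra.
rewrite /F bigcup_itvT probability_setT in h.
have {}h : (fun n : nat => (Phi n%:R - Phi (- n%:R))%:E) @ \oo --> (1 : R)%:E.
  have -> // : (fun n : nat => (Phi n%:R - Phi (- n%:R))%:E) = normal_prob 0 1 \o F.
  by apply/funext => n; rewrite /F /= PhiB //; have := ler0n R n; lra.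
have {}h : (fun n : nat => Phi n%:R - Phi (- n%:R)) @ \oo --> (1 : R).
  exact: fine_cvg h.
move/cvgrPdist_le: h => /(_ _ e0)[n _ /(_ n (leqnn n))] /=; rewrite ler_norml => /andP[_ hn].
exists n%:R => K nK; have a := Phi_le nK.
have b : Phi (- K) <= Phi (- n%:R) by apply: Phi_le; rewrite lerN2.
have := Phi_le1 n%:R; have := Phi_ge0 (- n%:R); split; lra.
Unshelve. all: by end_near. Qed.

(** * Piecewise linear test functions *)

Definition clip x : R := if x <= 0 then 0 else if 1 <= x then 1 else x.

Lemma clip_itv x : 0 <= clip x <= 1.
Proof. by rewrite /clip; case: (leP x 0) => a; [|case: (leP 1 x) => b]; apply/andP; split; lra. Qed.

Lemma clip_le x y : x <= y -> clip x <= clip y.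
Proof.
move=> xy; rewrite /clip; case: (leP x 0) => a; case: (leP y 0) => b;
  try case: (leP 1 x) => c; try case: (leP 1 y) => d; lra.
Qed.

Lemma clip_lip : lip 1 clip.
Proof.
move=> x y; rewrite mul1r.
have h1 := ler_norm (y - x); have h2 := ler_norm (- (y - x)); rewrite normrN in h2.
rewrite ler_norml /clip; case: (leP x 0) => a; case: (leP y 0) => b;
  try case: (leP 1 x) => c; try case: (leP 1 y) => d; apply/andP; split; lra.
Qed.

(** When [a + d <= b], a trapezoid that rises on [[a, a + d]], equals [1] up to [b] and falls on
    [[b, b + d]]. *)
Definition trap a b d x := clip ((x - a) / d) - clip ((x - b) / d).

Section Trapezoid.
Variables a b d : R.
Hypotheses (ab : a <= b) (d0 : 0 < d).

Lemma trap_itv x : 0 <= trap a b d x <= 1.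
Proof.
have h : clip ((x - b) / d) <= clip ((x - a) / d).
  by apply: clip_le; rewrite ler_pM2r ?invr_gt0 // lerD2l lerN2.
rewrite /trap.
have /andP[? ?] := clip_itv ((x - a) / d); have /andP[? ?] := clip_itv ((x - b) / d).
by apply/andP; split; lra.
Qed.

Lemma clip_lin0 x y : x <= y -> clip ((x - y) / d) = 0.
Proof. by move=> xy; rewrite /clip ifT // pmulr_lle0 ?invr_gt0 // subr_le0. Qed.

Lemma clip_lin1 x y : y + d <= x -> clip ((x - y) / d) = 1.
Proof.
move=> xy; have h : 0 < (x - y) / d.
  by rewrite divr_gt0 // subr_gt0 (lt_le_trans _ xy) // ltrDl.
rewrite /clip leNgt h /=.
by rewrite ifT // ler_pdivlMr // mul1r lerBrDl.
Qed.

Lemma trap_left x : x <= a -> trap a b d x = 0.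
Proof. by move=> xa; rewrite /trap !clip_lin0 ?subrr // (le_trans xa). Qed.

Lemma trap_right x : b + d <= x -> trap a b d x = 0.
Proof. by move=> bx; rewrite /trap !clip_lin1 ?subrr // (le_trans _ bx) // lerD2r. Qed.

Lemma trap_mid x : a + d <= x -> x <= b -> trap a b d x = 1.
Proof. by move=> ax xb; rewrite /trap clip_lin1 // clip_lin0 // subr0. Qed.

Lemma trap_lip : lip (2 / d) (trap a b d).
Proof.
move=> x y; rewrite /trap.
have h c : `|clip ((y - c) / d) - clip ((x - c) / d)| <= d^-1 * `|y - x|.
  apply: le_trans (clip_lip _ _) _; rewrite mul1r -mulrBl normrM mulrC.
  rewrite gtr0_norm ?invr_gt0 //.
  by rewrite (_ : y - c - (x - c) = y - x); last ring.
rewrite [X in `|X|](_ : _ = (clip ((y - a) / d) - clip ((x - a) / d)) -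
   (clip ((y - b) / d) - clip ((x - b) / d))); last by ring.
apply: le_trans (ler_normB _ _) _.
rewrite [leRHS](_ : _ = d^-1 * `|y - x| + d^-1 * `|y - x|); last by ring.
by rewrite lerD.
Qed.
End Trapezoid.

(** The assumptions of [stein_solution] except the zero Gaussian integral. *)
Definition adm q := exists K a b, [/\ 0 <= K, lip K q, a <= b,
  (forall x, x <= a -> q x = 0) & (forall x, b <= x -> q x = 0)].

Lemma adm_trap a b d : a <= b -> 0 < d -> adm (trap a b d).
Proof.
move=> ab d0; exists (2 / d), a, (b + d); split.
- by rewrite divr_ge0 // ltW.
- exact: trap_lip.
- by rewrite (le_trans ab) // lerDl ltW.
- by move=> x; exact: trap_left.
- by move=> x; exact: trap_right.
Qed.

Lemma adm_combine q1 q2 c : adm q1 -> adm q2 -> adm (fun x => q1 x - c * q2 x).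
Proof.
move=> [K1 [a1 [b1 [K10 L1 ab1 A1 B1]]]] [K2 [a2 [b2 [K20 L2 ab2 A2 B2]]]].
exists (K1 + `|c| * K2), (Num.min a1 a2), (Num.max b1 b2); split.
- by rewrite addr_ge0 // mulr_ge0.
- move=> x y; rewrite [X in `|X|](_ : _ = (q1 y - q1 x) - c * (q2 y - q2 x)); last by ring.
  apply: le_trans (ler_normB _ _) _; rewrite mulrDl.
  by apply: lerD; [exact: L1|rewrite normrM -mulrA ler_wpM2l // L2].
- by rewrite ge_min (le_trans ab1) // le_max lexx.
- by move=> x; rewrite le_min => /andP[/A1 -> /A2 ->]; rewrite mulr0 subrr.
- by move=> x; rewrite ge_max => /andP[/B1 -> /B2 ->]; rewrite mulr0 subrr.
Qed.

Lemma adm_integrable q : adm q -> mu.-integrable setT (EFin \o (fun x => q x * phi x)).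
Proof.
move=> [K [a [b [K0 L ab A B]]]]; have cq := lip_continuous L.
have [M _ qM] := compact_supp_bound ab cq A B.
exact: phi_mul_integrable cq qM.
Qed.

Lemma gint_combine q1 q2 c : adm q1 -> adm q2 ->
  gint (fun x => q1 x - c * q2 x) = gint q1 - c * gint q2.
Proof.
move=> h1 h2; have i1 := adm_integrable h1; have i2 := adm_integrable h2.
rewrite /gint -RintegralZl //.
rewrite -RintegralB //; last exact: (integrableZl measurableT c i2).
by apply: eq_Rintegral => x _; ring.
Qed.

Lemma Phi_restrict x : Phi x = \int[mu]_t (phi \_ `]-oo, x]) t.
Proof. by rewrite /Phi Rintegral_mkcond. Qed.

Lemma gint_le_Phi q x : adm q -> (forall t, q t <= 1) ->
  (forall t, x < t -> q t = 0) -> gint q <= Phi x.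
Proof.
move=> /adm_integrable iq q1 qx; rewrite Phi_restrict; apply: le_Rintegral => //.
  rewrite -restrict_EFin; apply/integrable_restrict => //; rewrite setTI.
  exact: integrableS (@phi_integrable R).
move=> t _; rewrite patchE; case: ifPn => [_|].
  by rewrite -[leRHS]mul1r ler_wpM2r // ltW ?phi_gt0.
by rewrite notin_setE /= in_itv /= => /negP; rewrite -ltNge => /qx ->; rewrite mul0r.
Qed.

Lemma gint_ge_Phi q x y : adm q -> (forall t, 0 <= q t) ->
  (forall t, y < t -> t <= x -> 1 <= q t) -> Phi x - Phi y <= gint q.
Proof.
move=> /adm_integrable iq q0 qx; have ri z : mu.-integrable setT (EFin \o (phi \_ `]-oo, z])).
  rewrite -restrict_EFin; apply/integrable_restrict => //; rewrite setTI.
  exact: integrableS (@phi_integrable R).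
rewrite !Phi_restrict -RintegralB //; apply: le_Rintegral => //.
  exact: (integrableB measurableT (ri x) (ri y)).
move=> t _; have p0 := ltW (phi_gt0 t); rewrite !patchE !mem_setE !in_itv /=.
have := q0 t; case: (leP t x) => tx; case: (leP t y) => ty h.
- by rewrite subrr mulr_ge0.
- by rewrite subr0 -[leLHS]mul1r ler_wpM2r // qx.
- by rewrite sub0r (le_trans _ (mulr_ge0 h p0)) // oppr_le0.
- by rewrite subr0 mulr_ge0.
Qed.

(** * From the Stein equation to distribution functions *)

Section Sequence.
Variable E : nat -> (R -> R) -> R.
Hypothesis E_lin : forall n q1 q2 c, E n (fun t => q1 t - c * q2 t) = E n q1 - c * E n q2.
Hypothesis E_le : forall n q1 q2, (forall t, q1 t <= q2 t) -> E n q1 <= E n q2.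
Hypothesis E_one : forall n, E n (fun=> 1) = 1.
Hypothesis E_sqr : \forall n \near \oo, E n (fun t => t ^+ 2) = 1.
Hypothesis E_stein : forall f f' L, 0 <= L ->
  (forall x y, `|f y - f x - f' x * (y - x)| <= L * (y - x) ^+ 2) ->
  (forall x y, `|f' y - f' x| <= L * `|y - x|) ->
  forall e, 0 < e -> \forall n \near \oo, `|E n f' - E n (fun t => t * f t)| <= e.

Lemma cvg_centered q : adm q -> gint q = 0 ->
  forall e, 0 < e -> \forall n \near \oo, `|E n q| <= e.
Proof.
move=> [K [a [b [K0 L ab A B]]]] q0 e e0.
have [f [f' [M [M0 fM f'M fq]]]] := stein_solution K0 L ab A B q0.
have := E_stein M0 fM f'M e0; apply: filterS => n.
have -> : q = fun t => f' t - 1 * (t * f t).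
  by apply/funext => t; rewrite mul1r fq.
by rewrite E_lin mul1r.
Qed.

(** Subtract from [q] a multiple of a wide trapezoid [p] so that the Gaussian integral vanishes and
    [cvg_centered] applies. Both [gint p] and, by Chebyshev's inequality, [E n p] are close to
    [1]. *)
Lemma cvg_adm q : adm q -> (forall t, 0 <= q t <= 1) ->
  forall e, 0 < e -> \forall n \near \oo, `|E n q - gint q| <= e.
Proof.
(* One [e'] is spent on the centred function and four on [c * (E n p - gint p)]; the cap [1 / 4]
   gives [gint p >= 1 / 2], hence [c <= 2]. *)
move=> aq q01 e e0; pose e' := Num.min (e / 5) 4^-1.
have e'0 : 0 < e' by rewrite /e' lt_min divr_gt0 //= invr_gt0.
have e'e : 5 * e' <= e.
  have : e' <= e / 5 by rewrite /e' ge_min lexx.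
  lra.
have e'4 : e' <= 4^-1 by rewrite /e' ge_min lexx orbT.
have [K0 tails] := Phi_tails e'0.
pose K := Num.max K0 (Num.max 1 e'^-1).
have [KK0 K1 Ke] : [/\ K0 <= K, 1 <= K & e'^-1 <= K].
  by split; rewrite /K !le_max lexx ?orbT.
have [t1 t2] := tails K KK0.
have K2 : K ^- 2 <= e'.
  rewrite -[leRHS]invrK lef_pV2 ?posrE ?exprn_gt0 ?invr_gt0 //; last by lra.
  by rewrite (le_trans Ke) // expr2 ler_peMr //; lra.
pose p := trap (- (K + 1)) K 1.
have KK : - (K + 1) <= K by lra.
have ap : adm p by apply: adm_trap => //; lra.
have p01 t : 0 <= p t <= 1 by apply: trap_itv.
have gp1 : gint p <= 1.
  apply: le_trans (Phi_le1 (K + 1)); apply: gint_le_Phi => // t.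
    by have /andP[] := p01 t.
  by move=> h; apply: trap_right => //; lra.
have gp2 : 1 - 2 * e' <= gint p.
  apply: (@le_trans _ _ (Phi K - Phi (- K))); first by lra.
  apply: gint_ge_Phi => // t; first by have /andP[] := p01 t.
  by move=> h1 h2; rewrite /p trap_mid //; lra.
have gq1 : gint q <= 1.
  have [L [a [b [L0 Lq ab A B]]]] := aq.
  apply: le_trans (Phi_le1 b); apply: gint_le_Phi => // t.
    by have /andP[] := q01 t.
  by move=> h; rewrite B // ltW.
have gq0 : 0 <= gint q.
  apply: Rintegral_ge0 => t _; apply: mulr_ge0; last exact/ltW/phi_gt0.
  by have /andP[] := q01 t.
have gp0 : 0 < gint p by lra.
pose c := gint q / gint p.
have c2 : 0 <= c <= 2.
  by rewrite divr_ge0 //= ?(ltW gp0) // ler_pdivrMr //; lra.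
have := cvg_centered (adm_combine c aq ap) _ e'0.
rewrite gint_combine // divfK ?gt_eqF // subrr => /(_ erefl) cen.
near=> n.
have sq : E n (fun t => t ^+ 2) = 1 by near: n.
have hc : `|E n q - c * E n p| <= e' by rewrite -E_lin; near: n.
have Ep1 : E n p <= 1 by rewrite -(E_one n); apply: E_le => t; have /andP[] := p01 t.
have Ep2 : 1 - K ^- 2 <= E n p.
  have -> : 1 - K ^- 2 = E n (fun t => 1 - K ^- 2 * t ^+ 2).
    by rewrite E_lin E_one sq mulr1.
  (* Chebyshev pointwise: [p] is [1] on [[- K, K]], and outside it [1 - K ^- 2 * t ^+ 2] is
     negative. *)
  apply: E_le => t.
  have /andP[pt0 _] := p01 t; have t20 := sqr_ge0 t.
  have Kp : 0 < K ^+ 2 by rewrite exprn_gt0 //; lra.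
  have [tK|Kt] := leP `|t| K.
    have -> : p t = 1.
      by move: tK; rewrite ler_norml => /andP[h1 h2]; rewrite /p trap_mid //; lra.
    by rewrite lerBlDr lerDl mulr_ge0 // invr_ge0 ltW.
  apply: le_trans pt0; rewrite subr_le0 mulrC ler_pdivlMr // mul1r.
  by rewrite -[t ^+ 2]real_normK ?num_real // ler_pXn2r ?nnegrE ?(ltW Kt) //; lra.
have gqE : gint q = c * gint p by rewrite divfK // gt_eqF.
have dp : `|c * (E n p - gint p)| <= 2 * (2 * e').
  have /andP[c0 c2'] := c2; rewrite normrM; apply: ler_pM => //; first by rewrite ger0_norm.
  by rewrite ler_norml; apply/andP; split; lra.
rewrite gqE (_ : _ - _ = (E n q - c * E n p) + c * (E n p - gint p)); last by ring.
by rewrite (le_trans (ler_normD _ _)) //; lra.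
Unshelve. all: by end_near. Qed.

(** The indicator of the half-line is squeezed between [q2] and [q1 + K ^- 2 * t ^+ 2]: the
    trapezoids have compact support, and the quadratic term covers the left tail. *)
Theorem cvg_cdf_Phi x :
  (fun n => E n (fun t => if t <= x then 1 else 0)) @ \oo --> Phi x.
Proof.
apply/cvgrPdist_le => e e0; pose e' := e / 4.
have e'0 : 0 < e' by rewrite divr_gt0.
(* [Phi] grows by at most [e'] over an interval of length [d]. *)
pose d := e' / peak; have pk := @peak_gt0 R.
have d0 : 0 < d by rewrite divr_gt0.
have pd : peak * d = e' by rewrite /d mulrC divfK // gt_eqF.
have [K0 tails] := Phi_tails e'0.
pose K := Num.max K0 (Num.max (1 + `|x| + 2 * d) e'^-1).
have [KK0 Kx Ke] : [/\ K0 <= K, 1 + `|x| + 2 * d <= K & e'^-1 <= K].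
  by split; rewrite /K !le_max lexx ?orbT.
have [x1 x2] : x <= `|x| /\ - x <= `|x|.
  by split; [exact: ler_norm|rewrite -normrN ler_norm].
have [t1 _] := tails K KK0.
have x0 : 0 <= `|x| by [].
have Kp : 0 < K ^+ 2 by rewrite exprn_gt0 //; lra.
have K2 : K ^- 2 <= e'.
  rewrite -[leRHS]invrK lef_pV2 ?posrE ?invr_gt0 //.
  by rewrite (le_trans Ke) // expr2 ler_peMr //; lra.
pose q1 := trap (- (K + d)) x d; pose q2 := trap (- K) (x - d) d.
have ab1 : - (K + d) <= x by lra.
have ab2 : - K <= x - d by lra.
have aq1 : adm q1 by exact: adm_trap.
have aq2 : adm q2 by exact: adm_trap.
have q1i t : 0 <= q1 t <= 1 by apply: trap_itv.
have q2i t : 0 <= q2 t <= 1 by apply: trap_itv.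
have g1 : gint q1 <= Phi x + e'.
  have : Phi (x + d) - Phi x <= peak * (x + d - x) by apply: Phi_lip; lra.
  rewrite addrAC subrr add0r pd => h.
  have : gint q1 <= Phi (x + d).
    apply: gint_le_Phi => // t; first by have /andP[] := q1i t.
    by move=> h'; apply: trap_right => //; lra.
  lra.
(* One [e'] is lost on each slope and one in the tail below [- K]. *)
have g2 : Phi x - 3 * e' <= gint q2.
  have : Phi x - Phi (x - d) <= peak * (x - (x - d)) by apply: Phi_lip; lra.
  rewrite (_ : x - (x - d) = d) ?pd => [h|]; last by ring.
  have : Phi (- K + d) - Phi (- K) <= peak * (- K + d - (- K)) by apply: Phi_lip; lra.
  rewrite addrAC subrr add0r pd => h'.
  have : Phi (x - d) - Phi (- K + d) <= gint q2.
    apply: gint_ge_Phi => // t; first by have /andP[] := q2i t.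
    by move=> h1 h2; rewrite /q2 trap_mid //; lra.
  lra.
near=> n.
have sq : E n (fun t => t ^+ 2) = 1 by near: n.
have c1 : `|E n q1 - gint q1| <= e' by near: n; exact: cvg_adm.
have c2 : `|E n q2 - gint q2| <= e' by near: n; exact: cvg_adm.
move: c1 c2; rewrite !ler_norml => /andP[_ c1] /andP[c2 _].
set F := E n _.
have up : F <= E n q1 - (- K ^- 2) * E n (fun t => t ^+ 2).
  rewrite -E_lin; apply: E_le => t; have /andP[qt0 _] := q1i t.
  have t20 : 0 <= K ^- 2 * t ^+ 2 by rewrite mulr_ge0 ?sqr_ge0 // invr_ge0 ltW.
  rewrite mulNr opprK; case: ifP => [tx|_]; last exact: addr_ge0.
  have [Kt|tK] := leP (- K) t.
    by rewrite /q1 trap_mid ?lerDl //; lra.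
  apply: (@le_trans _ _ (K ^- 2 * t ^+ 2)); last by rewrite lerDr.
  have [h1 h2] : 0 <= K /\ K <= - t by split; lra.
  rewrite mulrC ler_pdivlMr // mul1r -[t ^+ 2]sqrrN.
  by rewrite ler_pXn2r // nnegrE // (le_trans h1).
have low : E n q2 <= F.
  apply: E_le => t; case: ifP => [_|/negbT]; first by have /andP[] := q2i t.
  by rewrite -ltNge => xt; rewrite /q2 trap_right //; lra.
rewrite sq mulr1 opprK in up.
have e4 : e = 4 * e' by rewrite /e'; lra.
by apply/andP; split; lra.
Unshelve. all: by end_near. Qed.
End Sequence.
End Limit.

(** * The central limit theorem for descents *)

Section Conclusion.
Variables (R : realType) (M : forall n : nat, 'M[nat]_n).
Hypothesis HM : forall n, coxeter_matrix (M n).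
Hypothesis Hfin : forall n, finite_set (@coxW R n (M n)).

Definition coxE n (g : R -> R) : R := avg (coxenum R (M n)) (fun w => g (sdes (M n) w)).

Lemma cdf_coxE n x :
  des_cdf_std (M n) x = coxE n (fun t => if t <= x then 1 else 0).
Proof. by rewrite /des_cdf_std (coxavgE (Hfin n)). Qed.

Lemma sd_cvg_CLT : des_sd R (M n) @[n --> \oo] --> +oo ->
  forall x, (fun n => des_cdf_std (M n) x : R) @ \oo --> Phi x.
Proof.
move=> sdoo x.
have big (A : R) : \forall n \near \oo, A <= des_sd R (M n).
  by move/cvgryPge : sdoo; apply.
have -> : (fun n => des_cdf_std (M n) x : R) =
    (fun n => coxE n (fun t => if t <= x then 1 else 0)).
  by apply/funext => n; exact: cdf_coxE.
apply: cvg_cdf_Phi.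
- by move=> n q1 q2 c; rewrite /coxE avgB avgZ.
- by move=> n q1 q2 h; apply: ler_avg => w _; exact: h.
- by move=> n; rewrite /coxE avg_cst // size_coxenum.
- near=> n; apply: avg_sdes_sqr => //.
  by apply: (@lt_le_trans _ _ 1) => //; near: n.
- move=> f f' L L0 fL f'L e e0.
  have [C C0 st] : exists2 C : R, 0 <= C & forall n, 0 < des_sd R (M n) ->
      `|coxE n f' - coxE n (fun t => t * f t)| <= C * L / des_sd R (M n).
    by exists 1200; [exact: ler0n|move=> n sd0; exact: sdes_stein].
  near=> n.
  (* The added [1] also makes the standard deviation positive. *)
  have sdL : C * L / e + 1 <= des_sd R (M n) by near: n.
  have q0 : 0 <= C * L / e by rewrite divr_ge0 ?mulr_ge0 ?(ltW e0).
  have sd0 : 0 < des_sd R (M n) by lra.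
  apply: le_trans (st n sd0) _.
  by rewrite ler_pdivrMr // [leRHS]mulrC -ler_pdivrMr //; lra.
Unshelve. all: by end_near. Qed.

(* The standardized values lie in a translate of [Z / s_n], so the distribution
   function cannot increase on both halves of an interval shorter than [1 / s_n]. *)
Lemma cdf_flat n (A h : R) : 0 < h -> 2 * h * A = 1 -> des_sd R (M n) < A ->
  coxE n (fun t => if t <= 0 then 1 else 0) = coxE n (fun t => if t <= h then 1 else 0) \/
  coxE n (fun t => if t <= h then 1 else 0) =
  coxE n (fun t => if t <= 2 * h then 1 else 0).
Proof.
move=> h0 hA sdA; set sd := des_sd R (M n) in sdA.
have sd_ge0 : 0 <= sd by exact: sqrtr_ge0.
have flat a b : a <= b -> ~ (exists w, a < sdes (M n) w <= b) ->
    coxE n (fun t => if t <= a then 1 else 0) = coxE n (fun t => if t <= b then 1 else 0).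
  move=> ab nex; apply: eq_avg => w _; case: leP => [ta|ta].
    by rewrite (le_trans ta ab).
  by case: leP => // tb; case: nex; exists w; rewrite ta tb.
have [[w1 /andP[a1 b1]]|nex] := pselect (exists w, 0 < sdes (M n) w <= h); last first.
  by left; apply: flat => //; exact: ltW.
have [[w2 /andP[a2 b2]]|nex] := pselect (exists w, h < sdes (M n) w <= 2 * h); last first.
  by right; apply: flat => //; lra.
exfalso.
(* If [sd] were [0], division by zero would make every standardized value [0], against [a1]. *)
have sd0 : 0 < sd.
  rewrite lt_neqAle sd_ge0 andbT; apply: contraTneq a1 => sd0.
  by rewrite /sdes -/sd -sd0 invr0 mulr0 ltxx.
have e : sdes (M n) w2 - sdes (M n) w1 =
    ((ndes (M n) w2)%:R - (ndes (M n) w1)%:R) / sd.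
  by rewrite /sdes -/sd; ring.
have d0 : 0 < sdes (M n) w2 - sdes (M n) w1 < 2 * h by apply/andP; split; lra.
rewrite e in d0; move: d0 => /andP[d1 d2].
have {}d1 : (ndes (M n) w1 < ndes (M n) w2)%N.
  by move: d1; rewrite pmulr_lgt0 ?invr_gt0 // subr_gt0 ltr_nat.
have : 1 <= (ndes (M n) w2)%:R - (ndes (M n) w1)%:R :> R.
  by rewrite lerBrDr nat1r ler_nat.
move: d2; rewrite ltr_pdivrMr // => d2.
have : 2 * h * sd < 1 by rewrite -[ltRHS]hA ltr_pM2l // mulr_gt0.
lra.
Qed.

(** Were [des_sd] below [A] for a large [n], the distribution function would agree at two
    consecutive points among [0], [h], [2 * h] by [cdf_flat], whereas [Phi] strictly increases
    between them. *)
Lemma CLT_sd_cvg : (forall x, (fun n => des_cdf_std (M n) x : R) @ \oo --> Phi x) ->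
  des_sd R (M n) @[n --> \oo] --> +oo.
Proof.
move=> clt; apply/cvgryPge => A0; pose A := Num.max A0 1.
have [A1 A2] : A0 <= A /\ 1 <= A by split; rewrite /A le_max lexx ?orbT.
pose h := (2 * A)^-1.
have h0 : 0 < h by rewrite invr_gt0; lra.
have hA : 2 * h * A = 1 by rewrite /h; field; apply/eqP; lra.
have P1 : Phi (0 : R) < Phi h by exact: Phi_lt.
have P2 : Phi h < Phi (2 * h) by apply: Phi_lt; lra.
(* Two errors of size [e] remain below either increment of [Phi]. *)
pose e := Num.min ((Phi h - Phi 0) / 3) ((Phi (2 * h) - Phi h) / 3).
have e0 : 0 < e by rewrite /e lt_min !divr_gt0 // subr_gt0.
have [e1 e2] : e <= (Phi h - Phi 0) / 3 /\ e <= (Phi (2 * h) - Phi h) / 3.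
  by split; rewrite /e ge_min lexx ?orbT.
have close x : \forall n \near \oo,
    `|Phi x - coxE n (fun t => if t <= x then 1 else 0)| <= e.
  have := clt x => /cvgrPdist_le/(_ _ e0); apply: filterS => n.
  by rewrite cdf_coxE.
near=> n; apply: le_trans A1 _; rewrite leNgt; apply/negP => sdA.
have c0 : `|Phi 0 - coxE n (fun t => if t <= 0 then 1 else 0)| <= e by near: n.
have c1 : `|Phi h - coxE n (fun t => if t <= h then 1 else 0)| <= e by near: n.
have c2 : `|Phi (2 * h) - coxE n (fun t => if t <= 2 * h then 1 else 0)| <= e by near: n.
move: c0 c1 c2; rewrite !ler_norml => /andP[a0 b0] /andP[a1 b1] /andP[a2 b2].
by have [E|E] := cdf_flat h0 hA sdA; lra.
Unshelve. all: by end_near. Qed.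
End Conclusion.

Theorem theorem6p2 (R : realType) (M : forall n : nat, 'M[nat]_n)
  (HM : forall n, coxeter_matrix (M n))
  (Hfin : forall n, finite_set (@coxW R n (M n))) :
  satisfies_CLT (fun n => @des_cdf_std R n (M n))
  <-> (@des_sd R n (M n) @[n --> \oo] --> +oo).
Proof.
split=> [clt|sdoo x].
  by apply: CLT_sd_cvg => // x; have := clt x; rewrite PhiE => /fine_cvg.
by rewrite PhiE; apply: cvg_EFin; [exact: nearW|exact: sd_cvg_CLT].
Qed.
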